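(* Let $n\geq 1$ be an integer and let $P_1,\ldots,P_n\in\mathbb{R}[t]$ be nonzero real polynomials with $P_i(0)=0$ for $1\le i\le n$. Set $\gamma(t)=(P_1(t),\ldots,P_n(t))$. Then there exists a constant $c>0$ depending only on $\gamma$ such that the following holds. For every $\epsilon\in(0,1/2)$ and every Lebesgue measurable set $E\subset[0,1]^n$ with $|E|\geq\epsilon$, there exist $x\in\mathbb{R}^n$ and $t\in\mathbb{R}$ with $$x\in E,\qquad x+\gamma(t)\in E,\qquad t>\delta(\epsilon),$$ where $$\delta(\epsilon)=\exp\left(-\exp\left(c\,\epsilon^{-4}\right)\right).$$
   Context: $|E|$ denotes the Lebesgue measure of $E\subset\mathbb{R}^n$. *)

(* Defs.v *)
From HB Require Import structures.
From mathcomp Require Import all_boot all_order all_algebra.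
From mathcomp Require Import all_classical all_reals all_analysis.

Set Implicit Arguments.
Unset Strict Implicit.
Unset Printing Implicit Defensive.
Import Order.TTheory GRing.Theory Num.Theory.
Import numFieldNormedType.Exports.

Local Open Scope classical_set_scope.
Local Open Scope ring_scope.

(* R^n is n.-tuple R, the library's measurable structure on finite powers:
   the product sigma-algebra, generated here by the Borel sets of R. *)
Notation euclid R n := (n.-tuple (measurableTypeR R)).

Section LebesgueTuple.
Context {R : realType}.

Definition cons_pair n (p : measurableTypeR R * euclid R n) : euclid R n.+1 :=
  [tuple of p.1 :: p.2].

(* The n-fold product of the Lebesgue measure of R, on the Borel sets. *)
Fixpoint borel_lebesgue n : set (euclid R n) -> \bar R :=
  match n with
  | 0 => \d_([tuple] : euclid R 0)
  | m.+1 => pushforward (lebesgue_measure \x @borel_lebesgue m)%E (@cons_pair m)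
  end.

Lemma measurable_cons_pair n : measurable_fun setT (@cons_pair n).
Proof. exact: measurable_cons. Qed.

Section pushforward_cons.
Variables (n : nat) (m : {sigma_finite_measure set (euclid R n) -> \bar R}).

Let nu : set (euclid R n.+1) -> \bar R :=
  pushforward (lebesgue_measure \x m)%E (@cons_pair n).

Let nu0 : nu set0 = 0%E.
Proof. by rewrite /nu /pushforward preimage_set0 measure0. Qed.

Let nu_ge0 A : (0 <= nu A)%E.
Proof. by rewrite /nu /pushforward; exact: measure_ge0. Qed.

Let nu_sigma : semi_sigma_additive nu.
Proof.
move=> F mF tF mUF; rewrite /nu /pushforward preimage_bigcup.
apply: measure_semi_sigma_additive.
- by move=> k; rewrite -[X in measurable X]setTI; exact: measurable_cons_pair.
- apply/trivIsetP => /= i j _ _ ij; rewrite -preimage_setI.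
  by move/trivIsetP : tF => /(_ _ _ _ _ ij) ->//; rewrite preimage_set0.
- by rewrite -preimage_bigcup -[X in measurable X]setTI;
    exact: measurable_cons_pair.
Qed.

HB.instance Definition _ := isMeasure.Build _ _ _ nu nu0 nu_ge0 nu_sigma.

Let nu_sigma_finite : sigma_finite setT nu.
Proof.
have [F0 TF0 mF0] : sigma_finite setT (lebesgue_measure \x m)%E.
  have /sigma_finiteP[F [TF ndF Foo]] :=
    sigma_finiteT (@lebesgue_measure R).
  have /sigma_finiteP[G [TG ndG Goo]] := sigma_finiteT m.
  exists (fun k => F k `*` G k).
    rewrite -setXTT TF TG predeqE => -[x y]; split.
      move=> [/= [i _ Fx] [j _ Gy]]; exists (maxn i j) => //; split.
        by move: x Fx; exact/subsetPset/ndF/leq_maxl.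
      by move: y Gy; exact/subsetPset/ndG/leq_maxr.
    by move=> [k _ []/= ? ?]; split; exists k.
  move=> k; have [? ?] := Foo k; have [? ?] := Goo k.
  split; first exact: measurableX.
  by rewrite product_measure1E// lte_mul_pinfty// ge0_fin_numE.
pose u (x : euclid R n.+1) : measurableTypeR R * euclid R n :=
  (thead x, [tuple of behead x]).
have uK : cancel (@cons_pair n) u.
  by move=> [a t]; rewrite /u theadE; congr (_, _); exact/val_inj.
have mu : measurable_fun setT u.
  apply/measurable_fun_pairP; split; first exact: measurable_tnth.
  exact: measurable_behead.
exists (fun k => u @^-1` F0 k).
  by rewrite -preimage_bigcup -TF0 preimage_setT.
move=> k; split.
  by rewrite -[X in measurable X]setTI; apply: mu => //; exact: (mF0 k).1.
rewrite /nu /pushforward (_ : _ @^-1` _ = F0 k); first exact: (mF0 k).2.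
by apply/seteqP; split => p /=; rewrite uK.
Qed.

HB.instance Definition _ := Measure_isSigmaFinite.Build _ _ _ nu nu_sigma_finite.

Lemma pushforward_cons_measure :
  exists m' : {sigma_finite_measure set (euclid R n.+1) -> \bar R},
    m' = nu :> (set _ -> _).
Proof. by exists nu. Qed.

End pushforward_cons.

Lemma borel_lebesgue_measure n :
  exists m : {sigma_finite_measure set (euclid R n) -> \bar R},
    m = @borel_lebesgue n :> (set _ -> _).
Proof.
elim: n => [|n [m mE]]; first by exists (\d_([tuple] : euclid R 0)).
by have [m' m'E] := pushforward_cons_measure m; exists m'; rewrite m'E mE.
Qed.

Section instances.
Variable n : nat.

Let borel_lebesgue0 : @borel_lebesgue n set0 = 0%E.
Proof. by have [m <-] := borel_lebesgue_measure n; exact: measure0. Qed.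

Let borel_lebesgue_ge0 A : (0 <= @borel_lebesgue n A)%E.
Proof. by have [m <-] := borel_lebesgue_measure n; exact: measure_ge0. Qed.

Let borel_lebesgue_sigma_additive : semi_sigma_additive (@borel_lebesgue n).
Proof.
have [m <-] := borel_lebesgue_measure n.
exact: measure_semi_sigma_additive.
Qed.

HB.instance Definition _ := isMeasure.Build _ _ _ (@borel_lebesgue n)
  borel_lebesgue0 borel_lebesgue_ge0 borel_lebesgue_sigma_additive.

Let borel_lebesgue_sigma_finite : sigma_finite setT (@borel_lebesgue n).
Proof. by have [m <-] := borel_lebesgue_measure n; exact: sigma_finiteT. Qed.

HB.instance Definition _ := Measure_isSigmaFinite.Build _ _ _
  (@borel_lebesgue n) borel_lebesgue_sigma_finite.

End instances.

Lemma measurable_box n (a b : euclid R n) :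
  measurable [set x : euclid R n | forall i, tnth a i <= tnth x i <= tnth b i].
Proof.
rewrite (_ : [set x | _] = \bigcap_(i in [set: 'I_n])
    ((fun x : euclid R n => tnth x i) @^-1` `[tnth a i, tnth b i]%classic)).
  apply: fin_bigcap_measurable => // i _; rewrite -[X in measurable X]setTI.
  exact: measurable_tnth.
by apply/seteqP; split => x /= Bx i => [_|]; [|have := Bx i I];
  rewrite /= in_itv/=.
Qed.

Lemma borel_lebesgue_box n (a b : euclid R n) :
  (forall i, tnth a i <= tnth b i) ->
  borel_lebesgue [set x | forall i, tnth a i <= tnth x i <= tnth b i] =
  (\prod_(i < n) (tnth b i - tnth a i))%:E.
Proof.
elim: n a b => [|n IH] a b ab.
  rewrite big_ord0 /= diracE mem_set//; by case.
rewrite /= /pushforward.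
set A := (X in (_ \x _)%E X).
pose a' : euclid R n := [tuple of behead a].
pose b' : euclid R n := [tuple of behead b].
have a'E i : tnth a' i = tnth a (lift ord0 i).
  by rewrite (tuple_eta a) tnthS; congr tnth; apply/val_inj.
have b'E i : tnth b' i = tnth b (lift ord0 i).
  by rewrite (tuple_eta b) tnthS; congr tnth; apply/val_inj.
pose B : set (euclid R n) :=
  [set x | forall i, tnth a' i <= tnth x i <= tnth b' i].
have mB : measurable B by exact: measurable_box.
have AE : A = (`[tnth a ord0, tnth b ord0]%classic `*` B).
  apply/seteqP; split => -[x t] /=.
    move=> H; split.
      by have := H ord0; rewrite /= in_itv /= tnth0.
    by move=> i; have := H (lift ord0 i); rewrite tnthS a'E b'E.
  move=> [H1 H2] i; case: (unliftP ord0 i) => [j|] ->.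
    by have := H2 j; rewrite tnthS a'E b'E.
  by move: H1; rewrite /= in_itv /= tnth0.
rewrite AE product_measure1E// big_ord_recl EFinM; congr (_ * _)%E.
  rewrite [LHS]lebesgue_measure_itv/= lte_fin; case: ltP => //.
  by rewrite le_eqVlt ltNge ab orbF => /eqP ->; rewrite subrr.
rewrite [LHS]IH; last by move=> i; rewrite a'E b'E.
by congr EFin; apply: eq_bigr => i _; rewrite a'E b'E.
Qed.

(* Completing the Borel product measure yields the Lebesgue sigma-algebra and
   the Lebesgue measure of R^n, as lebesgue_measure.v does for n = 1. *)
Definition lebesgue_measurable n (E : set (n.-tuple R)) : Prop :=
  ((@borel_lebesgue n)^*)%mu.-cara.-measurable E.

Definition lebesgue_vol n (E : set (n.-tuple R)) : \bar R :=
  @completed_measure_extension _ _ _ (@borel_lebesgue n) E.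

Lemma borel_lebesgue_measurable n (E : set (euclid R n)) :
  measurable E -> lebesgue_measurable E.
Proof.
by move=> mE; apply: sub_caratheodory; exact: sub_sigma_algebra.
Qed.

Lemma lebesgue_vol_borel n (E : set (euclid R n)) :
  measurable E -> lebesgue_vol E = borel_lebesgue E.
Proof. exact: measurable_mu_extE. Qed.

Lemma lebesgue_vol_box n (a b : n.-tuple R) :
  (forall i, tnth a i <= tnth b i) ->
  lebesgue_vol [set x | forall i, tnth a i <= tnth x i <= tnth b i] =
  (\prod_(i < n) (tnth b i - tnth a i))%:E.
Proof.
move=> ab; rewrite lebesgue_vol_borel; first exact: borel_lebesgue_box.
exact: measurable_box.
Qed.

Definition unit_cube n : set (n.-tuple R) :=
  [set x | forall i, 0 <= tnth x i <= 1].

Definition poly_curve n (P : n.-tuple {poly R}) (t : R) : n.-tuple R :=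
  [tuple (tnth P i).[t] | i < n].

Definition tuple_add n (x y : n.-tuple R) : n.-tuple R :=
  [tuple tnth x i + tnth y i | i < n].

End LebesgueTuple.

Arguments unit_cube {R} n _.

(* Main.v *)
Require Import Defs.
From mathcomp Require Import all_boot all_order all_algebra.
From mathcomp Require Import complex.
From mathcomp Require Import all_classical all_reals all_analysis.
From mathcomp Require Import measurable_realfun.
From mathcomp Require Import zify ring lra.
Import Order.TTheory GRing.Theory Num.Theory.
Import numFieldNormedType.Exports.
Set Implicit Arguments.
Unset Strict Implicit.
Unset Printing Implicit Defensive.
Local Open Scope ring_scope.

(** Let [e(x) = exp(2 i pi x)]. The theorem reduces to a one-sided bound on
    trigonometric sums over polynomial times.

    Let [d] bound the degrees of the coordinates of the curve. At the times [t
    / L], with [L] a large integer and [0 < t < L], the displacement along the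
    curve is the image of the integer vector with coordinates [L ^ (d - i.+1) *
    t ^ i.+1], [i < d], under a linear map to R^n defined by the coefficients.
    Averaging over translates shows that some translate of the image of the box
    of side [L ^ d] meets E in a positive proportion, of order eps, of its
    points. It remains to find, in a dense subset A of the group (Z/M)^d with
    [M = 2 * L ^ d], two points that differ by such a vector
    ([discrete_recurrence]).

    By Fourier inversion in this group, the number of pairs with this
    difference, averaged over t, is a combination with nonnegative weights (the
    squares of the Fourier coefficients of A) of averages of [e(p(t))] over t,
    for real polynomials p without constant term. The trivial character has a
    weight proportional to the square of the density, so it is enough that the
    real parts of the averages are at least [- 1 / D] for all p simultaneously,
    with D of order 1/eps ([polynomial_vdc]): the values of the curve form a
    van der Corput set in the sense of Kamae and Mendes France.

    To obtain such averages, take sets of times at 2 D widely separated scales.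
    At a given scale N, either the average of [e(p(t))] is at most [1 / (2 D)]
    in modulus or the coefficients of p are, for all k, within N^-k of
    rationals with a bounded common denominator ([all_major]). In the second
    case p is nearly an integer at the times of all smaller scales, if these
    are chosen divisible enough. So at most one scale can contribute a negative
    term of order 1.

    The dichotomy [all_major] is an inverse theorem for Weyl sums. The leading
    coefficient is treated first ([leading_major]), by van der Corput
    differencing and induction on the degree. The other ones follow by
    induction on the degree along short progressions on which the leading term
    is constant. Each step only loses factors [2 ^ (D ^ O(1))], hence [t / L]
    is at least of this inverse size, which is much larger than the double
    exponential. *)

Lemma sumr_const_seq (V : nmodType) (I : Type) (s : seq I) (c : V) :
  \sum_(i <- s) c = c *+ size s.
Proof. by rewrite big_const_seq count_predT iter_addr_0. Qed.

Lemma bin_le_exp n k : ('C(n, k) <= 2 ^ n)%N.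
Proof.
elim: n k => [|n IH] [|k] //; first by rewrite bin0 expn_gt0.
by rewrite binS expnS mul2n -addnn leq_add.
Qed.

Lemma leq_expl m n e : (m <= n)%N -> (m ^ e <= n ^ e)%N.
Proof. by case: e => // e mn; rewrite leq_exp2r. Qed.

Lemma factnX_le n : (n`! <= n ^ n)%N.
Proof.
suff h m : (m <= n)%N -> (m`! <= n ^ m)%N by exact: h.
elim: m => // m IH mn; rewrite factS expnS leq_mul // IH // ltnW //.
Qed.

Lemma double_le_sqr D : (2 <= D -> 2 <= 2 * D <= D ^ 2)%N.
Proof.
by move=> D2; rewrite leq_pmulr ?(leq_trans _ D2) //= leq_mul2r D2 orbT.
Qed.

(** * Unit phases *)

Section Phases.
Context {R : realType}.
Implicit Types (x y : R) (z w : R[i]).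

(** The norm of [R[i]] takes its values in [R[i]]; a real-valued one gives
    access to the decision procedures for ordered fields. *)
Definition cabs z : R := ComplexField.Normc.normc z.

Lemma cabs_normE z : (cabs z)%:C%C = `|z|. Proof. by []. Qed.

Lemma cabs0 : cabs 0 = 0. Proof. exact: ComplexField.Normc.normc0. Qed.

Lemma cabs1 : cabs 1 = 1. Proof. exact: ComplexField.Normc.normc1. Qed.

Lemma cabsM z w : cabs (z * w) = cabs z * cabs w.
Proof. exact: ComplexField.Normc.normcM. Qed.

Lemma cabsD z w : cabs (z + w) <= cabs z + cabs w.
Proof. exact: le_normcD. Qed.

Lemma cabsN z : cabs (- z) = cabs z. Proof. exact: normcN. Qed.

Lemma cabs_ge0 z : 0 <= cabs z.
Proof. by rewrite -lecR cabs_normE normr_ge0. Qed.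

Lemma cabsB z w : cabs z - cabs w <= cabs (z - w).
Proof. by rewrite lerBlDr; apply: le_trans (cabsD _ _); rewrite subrK. Qed.

Lemma cabsC z w : cabs (z - w) = cabs (w - z).
Proof. by rewrite -cabsN opprB. Qed.

Lemma cabs_sum (I : Type) (s : seq I) (F : I -> R[i]) :
  cabs (\sum_(i <- s) F i) <= \sum_(i <- s) cabs (F i).
Proof.
apply: (big_ind2 (fun z x => cabs z <= x)) => //; first by rewrite cabs0.
by move=> x1 x2 y1 y2 h1 h2; apply: le_trans (cabsD _ _) _; exact: lerD.
Qed.

Lemma cabs_nat n : cabs n%:R = n%:R.
Proof.
by apply/eqP; rewrite -(inj_eq (@complexI R)) cabs_normE normr_nat rmorph_nat.
Qed.

Lemma cabs_sqr z : z * conjc z = (cabs z ^+ 2)%:C%C.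
Proof. by rewrite rmorphXn /= cabs_normE sqr_normc. Qed.

Lemma ReD z w : complex.Re (z + w) = complex.Re z + complex.Re w.
Proof. by case: z => a b; case: w. Qed.

Lemma Re_sum (I : Type) (s : seq I) (F : I -> R[i]) :
  complex.Re (\sum_(i <- s) F i) = \sum_(i <- s) complex.Re (F i).
Proof. exact: (big_morph _ ReD). Qed.

Lemma Re_realM x z : complex.Re (x%:C%C * z) = x * complex.Re z.
Proof. by case: z => a b /=; rewrite mul0r subr0. Qed.

Lemma Re_le_cabs z : `|complex.Re z| <= cabs z.
Proof. by rewrite -lecR cabs_normE; exact: normc_ge_Re. Qed.

Definition phase x : R[i] := (cos (2 * pi * x) +i* sin (2 * pi * x))%C.

Lemma phaseD x y : phase (x + y) = phase x * phase y.
Proof. by rewrite /phase mulrDr cosD sinD; simpc; congr (_ +i* _)%C; ring. Qed.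

Lemma phase0 : phase 0 = 1.
Proof. by rewrite /phase mulr0 cos0 sin0. Qed.

Lemma phaseN x : phase (- x) = conjc (phase x).
Proof. by rewrite /phase mulrN cosN sinN. Qed.

Lemma phaseB x y : phase (x - y) = phase x * conjc (phase y).
Proof. by rewrite phaseD phaseN. Qed.

Lemma cabs_phase x : cabs (phase x) = 1.
Proof. by rewrite /cabs /= cos2Dsin2 sqrtr1. Qed.

Lemma phase_nat n : phase n%:R = 1.
Proof.
elim: n => [|n IH]; first by rewrite phase0.
rewrite -addn1 natrD phaseD IH mul1r /phase mulr1.
by rewrite mulr_natl cos2pi sin2pi.
Qed.

Lemma phaseMn x n : phase (x *+ n) = phase x ^+ n.
Proof.
by elim: n => [|n IH]; rewrite ?phase0 // mulrS phaseD IH exprS.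
Qed.

(** The chord from [1] to [phase x], comparable to the distance from [x] to the
    nearest integer but subadditive without case analysis. *)
Definition dphase x : R := cabs (phase x - 1).

Lemma dphase_ge0 x : 0 <= dphase x. Proof. exact: cabs_ge0. Qed.

Lemma dphase0 : dphase 0 = 0. Proof. by rewrite /dphase phase0 subrr cabs0. Qed.

Lemma dphase_le2 x : dphase x <= 2.
Proof.
by apply: le_trans (cabsD _ _) _; rewrite cabsN cabs_phase cabs1.
Qed.

Lemma dphaseD x y : dphase (x + y) <= dphase x + dphase y.
Proof.
rewrite /dphase phaseD.
have -> : phase x * phase y - 1 = phase x * (phase y - 1) + (phase x - 1).
  by ring.
by apply: le_trans (cabsD _ _) _; rewrite cabsM cabs_phase mul1r addrC.
Qed.

Lemma dphaseN x : dphase (- x) = dphase x.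
Proof.
rewrite /dphase; have -> : phase (- x) - 1 = - (phase (- x) * (phase x - 1)).
  by rewrite mulrBr -phaseD addNr phase0 mulr1 opprB.
by rewrite cabsN cabsM cabs_phase mul1r.
Qed.

Lemma dphaseB x y : dphase (x - y) <= dphase x + dphase y.
Proof. by rewrite -(dphaseN y); exact: dphaseD. Qed.

Lemma dphase_sum (I : Type) (s : seq I) (P : pred I) (F : I -> R) :
  dphase (\sum_(i <- s | P i) F i) <= \sum_(i <- s | P i) dphase (F i).
Proof.
apply: (big_ind2 (fun x y => dphase x <= y)) => //; first by rewrite dphase0.
by move=> x1 x2 y1 y2 h1 h2; apply: le_trans (dphaseD _ _) _; exact: lerD.
Qed.

Lemma dphaseMn x n : dphase (x *+ n) <= dphase x *+ n.
Proof.
elim: n => [|n IH]; first by rewrite dphase0.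
by rewrite !mulrS; apply: le_trans (dphaseD _ _) _; exact: lerD.
Qed.

Lemma Re_phase_ge x : 1 - dphase x <= complex.Re (phase x).
Proof.
have := Re_le_cabs (phase x - 1); rewrite -/(dphase x) ReD.
have -> : complex.Re (-1 : R[i]) = -1 by rewrite /= .
by rewrite ler_norml => /andP[+ _]; lra.
Qed.

(** Converse of [dphaseMn] while [x *+ n] has not gone around the circle: in
    [phase (x *+ n) - 1 = (phase x - 1) * \sum_(i < n) phase (x *+ i)] every
    summand is within [1 / 2] of [1]. *)
Lemma dphaseMn_ge x n :
  dphase x *+ n *+ 2 <= 1 -> dphase x *+ n <= dphase (x *+ n) *+ 2.
Proof.
move=> small.
have geo : phase (x *+ n) - 1 = (phase x - 1) * \sum_(i < n) phase (x *+ i).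
  rewrite phaseMn subrX1; congr (_ * _); apply: eq_bigr => i _.
  by rewrite phaseMn.
have : n%:R - \sum_(i < n) dphase (x *+ i) <= cabs (\sum_(i < n) phase (x *+ i)).
  have -> : \sum_(i < n) phase (x *+ i) =
            n%:R - \sum_(i < n) (1 - phase (x *+ i)).
    by rewrite sumrB sumr_const card_ord opprB addrC subrK.
  apply: le_trans (cabsB _ _); rewrite cabs_nat lerD2l lerN2.
  apply: le_trans (cabs_sum _ _) _; apply: ler_sum => i _.
  by rewrite cabsC.
have : \sum_(i < n) dphase (x *+ i) <= n%:R * (1 / 2).
  rewrite [X in _ <= X]mulr_natl -[n in _ *+ n]card_ord -sumr_const.
  apply: ler_sum => i _; apply: le_trans (dphaseMn _ _) _.
  have : dphase x *+ i <= dphase x *+ n.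
    by apply: ler_wpMn2l; rewrite ?dphase_ge0 // ltnW.
  by rewrite -(mulr_natr _ 2) in small; lra.
move: (\sum_(i < n) dphase _) => S hS hn.
rewrite -mulr_natr -[leRHS]mulr_natr /dphase geo cabsM -mulrA.
apply: ler_wpM2l; first exact: cabs_ge0.
by move: (cabs _) hn => T; lra.
Qed.

Definition expsum (X : seq nat) (f : nat -> R) : R[i] :=
  \sum_(t <- X) phase (f t).

Lemma expsum_le X f : cabs (expsum X f) <= (size X)%:R.
Proof.
apply: le_trans (cabs_sum _ _) _.
under eq_bigr do rewrite cabs_phase.
by rewrite sumr_const_seq.
Qed.

End Phases.

(** * Growth of the form 2^(D^O(1)) *)

(** The constants below are bounded in this way in terms of the inverse density
    [D]. The class is closed under products, under powers with exponent
    polynomial in [D], under factorials of such polynomials, and under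
    polynomial substitutions. *)
Definition tame (F : nat -> nat) : Prop :=
  exists a, forall D, (2 <= D)%N -> (F D <= 2 ^ (D ^ a))%N.

Section Tame.
Local Open Scope nat_scope.
Implicit Types F G g : nat -> nat.

Lemma tame_le F G : (forall D, 2 <= D -> F D <= G D) -> tame G -> tame F.
Proof. by move=> FG [a Ga]; exists a => D D2;
  exact: leq_trans (FG _ D2) (Ga _ D2). Qed.

Lemma tame_const c : tame (fun=> c).
Proof.
exists c => D D2; apply: leq_trans (ltnW (ltn_expl c (ltnSn 1))) _.
rewrite leq_pexp2l //; apply: leq_trans (ltnW (ltn_expl c (ltnSn 1))) _.
by case: c => // c; rewrite leq_exp2r.
Qed.

Lemma tame_id : tame id.
Proof. by exists 1 => D _; rewrite expn1 ltnW // ltn_expl. Qed.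

Lemma tameM F G : tame F -> tame G -> tame (fun D => F D * G D).
Proof.
move=> [a Fa] [b Gb]; exists (a + b).+1 => D D2.
apply: leq_trans (leq_mul (Fa _ D2) (Gb _ D2)) _.
rewrite -expnD leq_pexp2l // expnS.
apply: (@leq_trans (2 * D ^ (a + b))); last by rewrite leq_mul2r D2 orbT.
have D0 : 0 < D by apply: ltn_trans D2.
by rewrite mul2n -addnn leq_add // leq_pexp2l // ?leq_addr ?leq_addl.
Qed.

Lemma tame_comp F g k :
  (forall D, 2 <= D -> 2 <= g D <= D ^ k) -> tame F -> tame (fun D => F (g D)).
Proof.
move=> gk [a Fa]; exists (k * a) => D D2; have /andP[g2 gD] := gk _ D2.
apply: leq_trans (Fa _ g2) _; rewrite leq_pexp2l // expnM.
by case: (a) => // b; rewrite leq_exp2r.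
Qed.

Lemma tame_expn F g k :
  (forall D, 2 <= D -> g D <= D ^ k) -> tame F -> tame (fun D => F D ^ g D).
Proof.
move=> gk [a Fa]; exists (a + k) => D D2.
apply: (@leq_trans ((2 ^ D ^ a) ^ g D)).
  by case: (g D) => // m; rewrite leq_exp2r // Fa.
by rewrite -expnM leq_pexp2l // expnD leq_mul2l gk ?orbT.
Qed.

Lemma tameX F k : tame F -> tame (fun D => F D ^ k).
Proof.
apply: (@tame_expn F (fun=> k) k) => D D2.
apply: leq_trans (ltnW (ltn_expl k (ltnSn 1))) _.
by case: k => // k; rewrite leq_exp2r.
Qed.

Lemma tame_fact g k :
  (forall D, 2 <= D -> g D <= D ^ k) -> tame (fun D => (g D) `!).
Proof.
move=> gk; apply: (@tame_le _ (fun D => (D ^ k) ^ g D)) => [D D2|].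
  apply: leq_trans (factnX_le _) _.
  by case: (g D) (gk _ D2) => // m mk; rewrite leq_exp2r.
by apply: tame_expn gk _; exact/tameX/tame_id.
Qed.

Lemma tameD F G : tame F -> tame G -> tame (fun D => F D + G D).
Proof.
move=> [a Fa] [b Gb]; exists (a + b).+1 => D D2.
apply: leq_trans (leq_add (Fa _ D2) (Gb _ D2)) _.
have D0 : 0 < D by apply: ltn_trans D2.
apply: (@leq_trans (2 ^ (D ^ (a + b)).+1)).
  by rewrite expnS mul2n -addnn leq_add // !leq_pexp2l // ?leq_addr ?leq_addl.
rewrite leq_pexp2l // expnS; apply: (@leq_trans (2 * D ^ (a + b))).
  by rewrite mul2n -addnn -addn1 leq_add2l expn_gt0 D0.
by rewrite leq_mul2r D2 orbT.
Qed.

End Tame.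

(** * Exponential sums and the leading coefficient *)

Section Leading.
Context {R : realType}.
Implicit Types (p q : {poly R}) (f : nat -> R) (X Y : seq nat).

Lemma sqr_sum_le (I : Type) (s : seq I) (a : I -> R) :
  (\sum_(i <- s) a i) ^+ 2 <= (size s)%:R * \sum_(i <- s) a i ^+ 2.
Proof.
elim: s => [|i s IH]; first by rewrite !big_nil expr0n mul0r.
rewrite !big_cons /=.
have cross : 2 * (\sum_(j <- s) a j) * a i <=
             \sum_(j <- s) a j ^+ 2 + (size s)%:R * a i ^+ 2.
  have -> : (size s)%:R * a i ^+ 2 = \sum_(j <- s) a i ^+ 2.
    by rewrite sumr_const_seq mulr_natl.
  rewrite -big_split /= mulr_sumr mulr_suml; apply: ler_sum => j _.
  by have := sqr_ge0 (a j - a i); rewrite sqrrB -mulr_natl; lra.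
move: (\sum_(j <- s) a j) (\sum_(j <- s) a j ^+ 2) IH cross => S Q IH cross.
by rewrite -[(size s).+1]addn1 natrD; lra.
Qed.

(** Van der Corput's inequality over a sumset: by Cauchy-Schwarz in [s],
    squaring replaces [f] by its differences, which have lower degree when [f]
    is a polynomial. *)
Lemma expsum_cat_sqr_le X Y f :
  cabs (expsum [seq (t + s)%N | t <- Y, s <- X] f) ^+ 2 <=
  (size X)%:R * \sum_(t' <- Y) \sum_(t <- Y)
     cabs (expsum X (fun s => f (t + s)%N - f (t' + s)%N)).
Proof.
rewrite /expsum big_allpairs_dep exchange_big /=.
apply: (@le_trans _ _
    ((\sum_(s <- X) cabs (\sum_(t <- Y) phase (f (t + s)%N))) ^+ 2)).
  by rewrite lerXn2r ?nnegrE ?cabs_ge0 ?cabs_sum // sumr_ge0 // => *;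
    exact: cabs_ge0.
apply: le_trans (sqr_sum_le _ _) _; apply: ler_wpM2l => //.
have -> : \sum_(s <- X) cabs (\sum_(t <- Y) phase (f (t + s)%N)) ^+ 2 =
    complex.Re (\sum_(t' <- Y) \sum_(t <- Y) \sum_(s <- X)
      phase (f (t + s)%N - f (t' + s)%N)).
  under [in RHS]eq_bigr do rewrite exchange_big.
  rewrite exchange_big Re_sum; apply: eq_bigr => s _ /=.
  rewrite -[LHS]/(complex.Re (_ ^+ 2)%:C%C) -cabs_sqr rmorph_sum mulr_sumr.
  congr complex.Re; apply: eq_bigr => t' _; rewrite mulr_suml.
  by apply: eq_bigr => t _; rewrite phaseB.
apply: le_trans (le_trans (ler_norm _) (Re_le_cabs _)) _.
apply: le_trans (cabs_sum _ _) _; apply: ler_sum => t' _.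
exact: cabs_sum.
Qed.

(** If the orbit of [x] returns near [0] at many times, then some bounded
    multiple of [x] is close to [0], with a gain of the length of the time
    interval. Two of the times differ by [g <= E], two others by some [h >= B].
    The point [x *+ (g * h)] is within [g * sigma] of [0] because [x *+ h] is
    within [sigma], and since [x *+ g] is too close to [0] to wrap around in
    [h] steps, [dphase (x *+ g)] is smaller by a factor [h]. *)
Lemma many_returns (x sigma : R) (E B : nat) (S : seq nat) :
    (0 < E)%N -> (0 < B)%N -> uniq S -> (B < size S)%N ->
    (forall t, t \in S -> (t < E * B)%N) ->
    (forall s t, s \in S -> t \in S -> (s <= t)%N ->
       dphase (x *+ (t - s)) <= sigma) ->
    sigma *+ (E * B) *+ 2 <= 1 ->
  exists2 g, (0 < g <= E)%N & dphase (x *+ g) *+ B <= sigma *+ E *+ 2.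
Proof.
move=> E0 B0 uS BS Slt ret small.
have [m mS mmin] : exists2 m, m \in S & forall t, t \in S -> (m <= t)%N.
  have : exists m, m \in S by case: (S) BS => // a s _; exists a;
    rewrite mem_head.
  move=> /[dup] exS /ex_minnP[m mS mmin]; exists m => //.
have [h hS mh] : exists2 h, h \in S & (m + B <= h)%N.
  apply/hasP; apply: contraT => /hasPn far; move: BS; rewrite ltnNge => /negP[].
  rewrite -(size_iota m B); apply: uniq_leq_size => // t tS.
  by rewrite mem_iota mmin //= ltnNge; exact: far.
have [s [t [sS tS st tsE]]] :
    exists s t, [/\ s \in S, t \in S, (s < t)%N & (t - s <= E)%N].
  have : ~~ uniq [seq (t %/ E)%N | t <- S].
    apply: contraL BS => uS'; rewrite -leqNgt -(size_map (fun t => t %/ E)%N).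
    rewrite -(size_iota 0 B); apply: uniq_leq_size => // _ /mapP[t tS ->].
    by rewrite mem_iota /= add0n ltn_divLR // mulnC Slt.
  have close a b : (a %/ E = b %/ E)%N -> (b - a <= E)%N.
    move=> ab; rewrite (divn_eq a E) (divn_eq b E) ab subnDl.
    by rewrite (leq_trans (leq_subr _ _)) // ltnW // ltn_mod.
  move=> /negP collide; apply: contrapT => none; apply: collide.
  rewrite map_inj_in_uniq // => a b aS bS ab.
  case: (ltngtP a b) => // lt_ab; case: none.
    by exists a, b; split => //; exact: close.
  by exists b, a; split => //; exact: close.
exists (t - s)%N; first by rewrite subn_gt0 st.
have Bh : (B <= h - m)%N by rewrite leq_subRL // mmin.
have hE : (h - m <= E * B)%N.
  by rewrite (leq_trans (leq_subr _ _)) // ltnW // Slt.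
have sg0 : 0 <= sigma by apply: le_trans (ret _ _ sS sS (leqnn s));
  exact: dphase_ge0.
set g := (t - s)%N; set y := x *+ g.
have y_small : dphase y <= sigma by apply: ret => //; exact: ltnW.
have lin : dphase y *+ (h - m) <= dphase (y *+ (h - m)) *+ 2.
  apply: dphaseMn_ge; apply: le_trans small; rewrite ler_wMn2r //.
  apply: le_trans (ler_wpMn2l sg0 hE); exact: ler_wMn2r.
apply: le_trans (ler_wpMn2l (dphase_ge0 _) Bh) _; apply: le_trans lin _.
rewrite ler_wMn2r // /y mulrnAC; apply: le_trans (dphaseMn _ _) _.
apply: (@le_trans _ _ (sigma *+ g)); last exact: ler_wpMn2l.
by apply: ler_wMn2r; apply: ret => //; exact: mmin.
Qed.

(** A lower bound [1 / D] for the modulus of the average of [phase \o f], in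
    division-free form. *)
Definition large_expsum (D : nat) X f : Prop :=
  (size X)%:R <= D%:R * cabs (expsum X f).

Definition poly_shift p (c : R) : {poly R} := \poly_(i < size p) p^`N(i).[c].

Lemma horner_shift p c x : (poly_shift p c).[x] = p.[c + x].
Proof.
by rewrite nderiv_taylor; [rewrite horner_poly|exact: mulrC].
Qed.

Lemma horner_nderivn m p c i : (size p <= m)%N ->
  p^`N(i).[c] = \sum_(i <= k < m) p`_k *+ 'C(k, i) * c ^+ (k - i).
Proof.
move=> pm; rewrite (@horner_coef_wide _ (m - i)); last first.
  apply/leq_sizeP => j hj; rewrite coef_nderivn nth_default ?mul0rn //.
  by apply: leq_trans pm _; rewrite -leq_subLR.
rewrite -[X in \sum_(X <= _ < _) _]add0n big_addn.
rewrite -(big_mkord xpredT (fun j => p^`N(i)`_j * c ^+ j)).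
by apply: eq_big_nat => j _; rewrite coef_nderivn addnC addnK.
Qed.

Lemma sum_le_count (I : eqType) (Y : seq I) (a : I -> R) (b c : R) :
  0 <= b -> (forall t, a t <= c) ->
  \sum_(t <- Y) a t <= b *+ size Y + c *+ count (fun t => b < a t) Y.
Proof.
move=> b0 ac; elim: Y => [|t Y IH]; first by rewrite big_nil !mulr0n addr0.
rewrite big_cons /= mulrS mulrnDr addrACA; apply: lerD => //.
case: ltP => bt; last by rewrite mulr0n addr0.
by rewrite mulr1n -[leLHS]add0r lerD.
Qed.

(** The sum of a geometric progression of ratio [phase p`_1] is at most [2 /
    dphase p`_1]. *)
Lemma leading_major0 (D N : nat) p : (0 < D)%N -> (size p <= 2)%N ->
  large_expsum D (iota 1 (2 * D * N)) (fun t => p.[t%:R]) ->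
  dphase p`_1 *+ N <= 1.
Proof.
move=> D0 p2; rewrite /large_expsum size_iota.
set n := (2 * D * N)%N; set S := expsum _ _ => large.
have geo : cabs S * dphase p`_1 <= 2.
  rewrite /dphase -cabsM /S /expsum (_ : _ * _ =
      phase (p`_0 + p`_1 *+ n.+1) - phase (p`_0 + p`_1)).
    by apply: le_trans (cabsD _ _) _; rewrite cabsN !cabs_phase.
  elim: (n) => [|k IH]; first by rewrite big_nil mul0r mulr1n subrr.
  have -> : iota 1 k.+1 = iota 1 k ++ [:: k.+1].
    by rewrite -[X in iota 1 X]addn1 iotaD add1n.
  rewrite big_cat /= big_seq1 mulrDl IH.
  rewrite (@horner_coef_wide _ 2) // big_ord_recl big_ord1 /= expr0 mulr1.
  rewrite expr1 mulr_natr [p`_1 *+ k.+2]mulrSr addrA.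
  by rewrite [phase (_ + _ + p`_1)]phaseD; ring.
have : n%:R * dphase p`_1 <= 2 * D%:R.
  apply: le_trans (ler_wpM2r (dphase_ge0 _) large) _.
  by rewrite -mulrA mulrC; apply: ler_wpM2r.
rewrite /n 2!natrM -[dphase _ *+ N]mulr_natr => h.
have D0' : 0 < 2 * D%:R :> R by rewrite mulr_gt0 // ltr0n.
by rewrite -(ler_pM2l D0') mulr1; apply: le_trans h;
  rewrite -mulrA [_ * N%:R]mulrC.
Qed.


Lemma horner_nderivn_top p c d : (size p <= d.+1)%N -> p^`N(d).[c] = p`_d.
Proof.
by move=> pd; rewrite (horner_nderivn _ _ pd) big_nat1 binn mulr1n subnn mulr1.
Qed.

Lemma horner_nderivn_pretop p c d : (size p <= d.+2)%N ->
  p^`N(d).[c] = p`_d + p`_d.+1 *+ d.+1 * c.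
Proof.
move=> pd; rewrite (horner_nderivn _ _ pd) big_nat_recl // big_nat1.
by rewrite binn mulr1n subnn mulr1 binSn subSnn expr1.
Qed.

(** The polynomial [p.[a + x] - p.[b + x]] in [x], truncated below degree [d]:
    the terms of degree [d] cancel when [p] has degree [d]. *)
Definition poly_diff d p (a b : R) : {poly R} :=
  \poly_(i < d) (p^`N(i).[a] - p^`N(i).[b]).

Lemma horner_poly_diff d p a b x : (size p <= d.+1)%N ->
  (poly_diff d p a b).[x] = p.[a + x] - p.[b + x].
Proof.
move=> pd; rewrite -!horner_shift.
have wide q : (size q <= d.+1)%N -> q.[x] = \sum_(i < d.+1) q`_i * x ^+ i.
  by move=> qd; rewrite (horner_coef_wide _ qd).
rewrite wide; last exact: leqW (size_poly _ _).
rewrite wide; last exact: leq_trans (size_poly _ _) pd.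
rewrite wide; last exact: leq_trans (size_poly _ _) pd.
rewrite -sumrB !big_ord_recr /= /poly_diff /poly_shift !coef_poly ltnn.
have top : (if (d < size p)%N then p^`N(d).[a] else 0) * x ^+ d -
           (if (d < size p)%N then p^`N(d).[b] else 0) * x ^+ d = 0.
  by case: ifP => _; rewrite ?horner_nderivn_top // subrr.
rewrite mul0r addr0 top addr0; apply: eq_bigr => i _.
rewrite !coef_poly ltn_ord; case: ifP => [_|/negbT ip]; first by rewrite mulrBl.
have -> : p^`N(i) = 0.
  apply/polyP => j; rewrite coef_nderivn coef0 nth_default ?mul0rn //.
  by rewrite (leq_trans _ (leq_addr _ _)) // leqNgt.
by rewrite !(horner0, mul0r, subrr).
Qed.

(** By [expsum_cat_sqr_le] the sums of differences are large on average over
    [t] and [t'], so for some [t'] they are large for a positive proportion of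
    the [t]. The length [H] is such that these [t] are more than [B], a
    proportion [1 / (4 * D ^ 2)], as [many_returns] requires. *)
Lemma many_large_differences (D B : nat) X f :
    (0 < D)%N -> (0 < B)%N -> (0 < size X)%N ->
    let H := (4 * D ^ 2 * B)%N in
    large_expsum D [seq (t + s)%N | t <- iota 0 H, s <- X] f ->
  exists t', (B < count (fun t => (size X)%:R < (2 * D ^ 2)%:R *
     cabs (expsum X (fun s => f (t + s)%N - f (t' + s)%N)))%R (iota 0 H))%N.
Proof.
move=> D0 B0 X0 H large; apply: contrapT => none.
set a := fun t t' => cabs (expsum X (fun s => f (t + s)%N - f (t' + s)%N)).
set n : R := (size X)%:R; set b := n / (2 * D ^ 2)%:R.
have n0 : 0 < n by rewrite ltr0n.
have E0 : 0 < (2 * D ^ 2)%:R :> R by rewrite ltr0n muln_gt0 expn_gt0 D0.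
have few t' : \sum_(t <- iota 0 H) a t t' <= n *+ (3 * B).
  apply: le_trans (sum_le_count (b := b) (c := n) _ _ _) _.
  - by rewrite divr_ge0 ?ltW.
  - by move=> t; exact: expsum_le.
  have -> : b *+ size (iota 0 H) = n *+ (2 * B).
    rewrite size_iota /b -[LHS]mulr_natr -[RHS]mulr_natr /H !natrM.
    by field; rewrite pnatr_eq0 -lt0n.
  rewrite -mulrnDr; apply: ler_wpMn2l; first exact: ltW.
  rewrite (_ : 3 * B = 2 * B + B)%N; last by rewrite -[in RHS](mul1n B); lia.
  rewrite leq_add2l leqNgt; apply/negP => many; apply: none; exists t'.
  apply: leq_trans many _; rewrite leq_eqVlt; apply/orP; left; apply/eqP.
  by apply: eq_count => t; rewrite /b ltr_pdivrMr // mulrC.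
have := expsum_cat_sqr_le X (iota 0 H) f.
move: large; rewrite /large_expsum size_allpairs size_iota.
set A := cabs _ => large vdc.
have {}vdc : A ^+ 2 <= n * (n *+ (3 * B) *+ H).
  apply: le_trans vdc _; apply: ler_wpM2l; first exact: ltW.
  rewrite -[X in _ *+ X](size_iota 0 H) -sumr_const_seq;
    apply: ler_sum => t' _; exact: few.
have : ((H * size X)%:R) ^+ 2 <= D%:R ^+ 2 * (n * (n *+ (3 * B) *+ H)).
  apply: le_trans (ler_wpM2l (sqr_ge0 _) vdc); rewrite -exprMn.
  by rewrite lerXn2r ?nnegrE // mulr_ge0 // cabs_ge0.
rewrite -[_ *+ H]mulr_natr -[n *+ _]mulr_natr !natrM -/n.
have D0' : 0 < D%:R :> R by rewrite ltr0n.
have B0' : 0 < B%:R :> R by rewrite ltr0n.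
apply/negP; rewrite -ltNge -subr_gt0 expr2.
set l := (X in X - _); set r := (X in _ - X).
have -> : l - r = D%:R ^+ 2 * B%:R * n ^+ 2 * (4 * D%:R ^+ 2 * B%:R).
  by rewrite /l /r; ring.
by rewrite !mulr_gt0 // exprn_gt0.
Qed.


(** The differences [p.[t + s] - p.[t' + s]] have degree one less, with leading
    coefficient proportional to [(t - t') * p`_d.+2]. Applied to many [t], the
    result in degree [d.+1] says that this multiple of the leading coefficient
    returns near [0] at many times, so [many_returns] applies. *)
Lemma leading_step d D W N X p :
    let E := (4 * D ^ 2)%N in let B := (4 * E * E `! * N)%N in
    let H := (E * B)%N in
    (0 < D)%N -> (0 < N)%N -> (0 < size X)%N ->
    (forall q, (size q <= d.+2)%N ->
       large_expsum (2 * D ^ 2) X (fun s => q.[s%:R]) ->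
       dphase (q`_d.+1 *+ W) *+ (4 * H) ^ d.+1 <= 1) ->
    (size p <= d.+3)%N ->
    large_expsum D [seq (t + s)%N | t <- iota 0 H, s <- X]
      (fun t => p.[t%:R]) ->
  dphase (p`_d.+2 *+ (W * d.+2 * E `!)) *+ N ^ d.+2 <= 1.
Proof.
move=> E B H D0 N0 X0 IH pd large.
have E0 : (0 < E)%N by rewrite muln_gt0 expn_gt0 D0.
have B0 : (0 < B)%N by rewrite !muln_gt0 D0 fact_gt0 N0.
have [t' many] := many_large_differences D0 B0 X0 large.
set good := (fun t => _ < _) in many.
set sigma : R := ((4 * H)%:R ^+ d.+1)^-1.
have H0 : (0 < H)%N by rewrite /H muln_gt0 E0 B0.
have sigma0 : 0 < sigma by rewrite invr_gt0 exprn_gt0 // ltr0n muln_gt0 H0.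
set alpha := p`_d.+2; set x := alpha *+ (W * d.+2).
(* The leading coefficient of the difference at [t] is [beta t]. *)
pose beta (t : nat) := alpha *+ d.+2 * (t%:R - t'%:R).
have goodP t : good t -> dphase (beta t *+ W) <= sigma.
  move=> gt; pose q := poly_diff d.+2 p t%:R t'%:R.
  have -> : beta t = q`_d.+1.
    rewrite /q /poly_diff coef_poly leqnn !horner_nderivn_pretop //.
    by rewrite opprD addrACA subrr add0r -mulrBr.
  have := IH q (size_poly _ _); rewrite -[_ *+ _ ^ _]mulr_natr natrX => IHq.
  rewrite -[leRHS]div1r ler_pdivlMr;
    last by rewrite exprn_gt0 // ltr0n muln_gt0 H0.
  apply: IHq; apply: ltW; rewrite /large_expsum; apply: lt_le_trans gt _.
  rewrite le_eqVlt; apply/orP; left; apply/eqP; congr (_ * cabs _).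
  by apply: eq_bigr => s _; rewrite horner_poly_diff // !natrD.
pose S := [seq t <- iota 0 H | good t].
have [g /andP[g0 gE] small] : exists2 g, (0 < g <= E)%N &
    dphase (x *+ g) *+ B <= (sigma *+ 2) *+ E *+ 2.
  apply: (@many_returns x (sigma *+ 2) E B S) => //.
  - by rewrite filter_uniq ?iota_uniq.
  - by rewrite size_filter.
  - by move=> t; rewrite mem_filter mem_iota => /andP[_ /andP[]].
  - move=> s t; rewrite !mem_filter => /andP[/goodP gs _] /andP[/goodP gt _] st.
    have -> : x *+ (t - s) = beta t *+ W - beta s *+ W.
      rewrite -[x *+ _]mulr_natr natrB // /x mulrnA mulrnAC.
      by rewrite -mulrnBl /beta -[in RHS]mulrBr -mulrnAl; congr (_ * _); ring.
    by apply: le_trans (dphaseB _ _) _; rewrite mulr2n lerD.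
  - rewrite -!mulrnA -mulr_natr mulrC -ler_pdivlMr // /sigma div1r invrK.
    rewrite -natrX ler_nat expnS (_ : (2 * (E * B * 2)) = 4 * H)%N; last first.
      by rewrite /H; lia.
    by rewrite leq_pmulr // expn_gt0 muln_gt0 H0.
have : dphase (x *+ E`!) *+ (N * (4 * E * E`!)) <= sigma *+ (4 * E * E`!).
  have /dvdnP[k Ek] : (g %| E`!)%N by rewrite dvdn_fact // g0.
  have kE : (k <= E`!)%N by rewrite Ek leq_pmulr.
  have -> : x *+ E`! = (x *+ g) *+ k by rewrite [in LHS]Ek [(k * g)%N]mulnC mulrnA.
  apply: le_trans (ler_wMn2r _ (dphaseMn _ _)) _.
  rewrite mulnC -[(_ * N)%N]/B mulrnAC.
  apply: le_trans (ler_wpMn2l _ kE) _; first by rewrite mulrn_wge0 ?dphase_ge0.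
  apply: le_trans (ler_wMn2r _ small) _.
  by rewrite -!mulrnA; apply: ler_wpMn2l; rewrite ?ltW //; lia.
have cst0 : (0 < 4 * E * E`!)%N by rewrite !muln_gt0 D0 fact_gt0.
rewrite mulrnA ler_pMn2r // => xN.
have -> : p`_d.+2 *+ (W * d.+2 * E`!) = x *+ E`! by rewrite mulrnA.
rewrite expnS [dphase _ *+ _]mulrnA.
apply: le_trans (ler_wMn2r _ xN) _.
rewrite -mulr_natr mulrC /sigma ler_pdivrMr; last first.
  by rewrite exprn_gt0 // ltr0n muln_gt0 H0.
rewrite mul1r -natrX ler_nat leq_exp2r //.
have : (0 < 4 * E * E`!)%N by [].
by rewrite /H /B; nia.
Qed.

(** Weyl's inequality in inverse form, by induction on the degree. The set of
    times may be chosen, and sumsets of intervals are convenient: differencing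
    over them produces no boundary terms. *)
Theorem leading_major d : exists W K : nat -> nat,
  [/\ tame W, tame K, (forall D, 0 < W D)%N &
      forall D N, (2 <= D)%N -> (0 < N)%N -> exists X,
        [/\ (0 < size X)%N, {in X, forall t, (0 < t <= K D * N)%N} &
            forall p, (size p <= d.+2)%N ->
              large_expsum D X (fun t => p.[t%:R]) ->
              dphase (p`_d.+1 *+ W D) *+ N ^ d.+1 <= 1]].
Proof.
elim: d => [|d [W [K [tW tK W0 IH]]]].
  exists (fun=> 1%N), (fun D => 2 * D)%N; split => //.
  - exact: tame_const.
  - by apply: tameM tame_id; exact: tame_const.
  move=> D N D2 N0; have D0 : (0 < D)%N by apply: ltn_trans D2.
  exists (iota 1 (2 * D * N)); split.
  - by rewrite size_iota !muln_gt0 D0.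
  - by move=> t; rewrite mem_iota add1n ltnS.
  - by move=> p p2 /leading_major0; rewrite mulr1n expn1; exact.
(* [C D * N] is the length [H] of the interval in [leading_step]. *)
pose E D := (4 * D ^ 2)%N; pose C D := (E D * (4 * E D * (E D)`!))%N.
have sq D : (2 <= D -> 2 <= 2 * D ^ 2 <= D ^ 3)%N.
  by move=> D2;
    rewrite leq_pmulr ?expn_gt0 ?(leq_trans _ D2) //= expnS leq_mul2r D2 orbT.
have E4 D : (2 <= D -> E D <= D ^ 4)%N.
  move=> D2; rewrite (expnD D 2 2) leq_mul2r; apply/orP; right.
  by rewrite (@leq_exp2r 2 D 2).
have tE : tame E by apply: tameM (tame_const 4) (tameX 2 tame_id).
have tEf : tame (fun D => (E D)`!) by exact: tame_fact E4.
have tC : tame C by apply: tameM tE (tameM (tameM (tame_const 4) tE) tEf).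
exists (fun D => W (2 * D ^ 2) * d.+2 * (E D)`!)%N.
exists (fun D => C D + K (2 * D ^ 2) * (4 * C D))%N; split.
- by apply: (tameM (tameM (tame_comp sq tW) (tame_const _)) tEf).
- apply: (tameD tC); apply: (tameM (tame_comp sq tK)).
  exact: (tameM (tame_const 4) tC).
- by move=> D; rewrite !muln_gt0 W0 fact_gt0.
move=> D N D2 N0; have D0 : (0 < D)%N by apply: ltn_trans D2.
pose H := (E D * (4 * E D * (E D)`! * N))%N.
have H0 : (0 < H)%N by rewrite !muln_gt0 D0 fact_gt0 N0.
have /andP[E2 _] := sq _ D2.
have [|X [X0 Xle large]] := IH _ (4 * H)%N E2; first by rewrite muln_gt0 H0.
exists [seq (t + s)%N | t <- iota 0 H, s <- X]; split.
- by rewrite size_allpairs size_iota muln_gt0 H0.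
- move=> _ /allpairsP[[t s] /= [tH sX ->]]; have /andP[s0 sK] := Xle _ sX.
  rewrite addn_gt0 s0 orbT /= mulnDl leq_add //.
    by move: tH; rewrite mem_iota => /andP[_ /ltnW]; rewrite add0n /H /C mulnA.
  by apply: leq_trans sK _; rewrite /H /C !mulnA.
- by move=> p pd; apply: leading_step.
Qed.

End Leading.

(** * Exponential sums and all coefficients *)

Section AllCoefficients.
Context {R : realType}.
Implicit Types (p q r : {poly R}) (f : nat -> R) (X Y : seq nat).

Lemma poly_shiftE p c : poly_shift p c = p \Po ('X + c%:P).
Proof.
rewrite /comp_poly addrC nderiv_taylor; last exact: mulrC.
rewrite size_map_polyC /poly_shift poly_def; apply: eq_bigr => i _.
by rewrite nderivn_map horner_map mul_polyC.
Qed.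

Lemma poly_shiftK p c : poly_shift (poly_shift p c) (- c) = p.
Proof.
rewrite !poly_shiftE -comp_polyA comp_polyD comp_polyX comp_polyC.
by rewrite polyCN addrNK comp_polyXr.
Qed.

Lemma large_expsum_fiber D (X Y : seq nat) (f : nat -> nat -> R) :
    cabs (\sum_(s <- Y) expsum X (f s)) * D%:R >= (size X * size Y)%:R ->
    (0 < size Y)%N ->
  exists2 s, s \in Y & large_expsum D X (f s).
Proof.
move=> large Y0; apply: contrapT => none.
have : cabs (\sum_(s <- Y) expsum X (f s)) * D%:R < (size X * size Y)%:R.
  apply: (@le_lt_trans _ _ (\sum_(s <- Y) cabs (expsum X (f s)) * D%:R)).
    by rewrite -mulr_suml ler_wpM2r // cabs_sum.
  rewrite natrM mulr_natr -sumr_const_seq.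
  have {}none s : s \in Y -> cabs (expsum X (f s)) * D%:R < (size X)%:R.
    move=> sY; rewrite ltNge; apply/negP => le; apply: none; exists s => //.
    by rewrite /large_expsum mulrC.
  case: Y Y0 none {large} => // s Y _ none; rewrite !big_cons.
  apply: ltr_leD; first by apply: none; rewrite mem_head.
  rewrite big_seq [leRHS]big_seq; apply: ler_sum => t tY; apply: ltW.
  by apply: none; rewrite in_cons tY orbT.
by rewrite ltNge large.
Qed.

Lemma dphase_mulXn (x : R) (T m : nat) :
  dphase (x * (- T%:R) ^+ m) <= dphase x *+ T ^ m.
Proof.
rewrite exprNn mulrCA -natrX -signr_odd.
have -> : x * (T ^ m)%:R = x *+ (T ^ m) by rewrite mulr_natr.
by case: (odd m); rewrite ?expr1 ?expr0 ?mulN1r ?mul1r ?dphaseN dphaseMn.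
Qed.

(** The coefficients of [p] are combinations of those of its translate by [T],
    by Taylor expansion at [- T]. Since [T <= L * M], a bound [M ^- i] on the
    coefficient of index [i] contributes at most a multiple of [M ^- k] to the
    one of index [k]. *)
Lemma coef_of_shift d p (W W0 M L T k : nat) :
    (size p <= d.+2)%N -> (0 < M)%N -> (T <= L * M)%N ->
    (0 < W0)%N -> (0 < L)%N ->
    (0 < k <= d.+1)%N ->
    (forall i, (0 < i <= d.+1)%N ->
       dphase ((poly_shift p T%:R)`_i *+ (W0 ^ i * W)) *+ M ^ i <= 1) ->
  dphase (p`_k *+ (W * W0 ^ d.+1)) *+ M ^ k <=
    (d.+2 * (2 ^ d.+1 * W0 ^ d.+1 * L ^ d.+1))%:R.
Proof.
move=> pd M0 TL W00 L0 /andP[k0 kd] shift; set r := poly_shift p _ in shift.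
have rd : (size r <= d.+2)%N by apply: leq_trans (size_poly _ _) pd.
have pk : p`_k = \sum_(k <= i < d.+2) r`_i *+ 'C(i, k) * (- T%:R) ^+ (i - k).
  rewrite -(horner_nderivn _ _ rd) -[p in LHS](poly_shiftK p T%:R) -/r.
  rewrite /poly_shift coef_poly; case: ltnP => // rk.
  have -> : r^`N(k) = 0; last by rewrite horner0.
  apply/polyP => j; rewrite coef_nderivn coef0 nth_default ?mul0rn //.
  by rewrite (leq_trans rk) ?leq_addr.
rewrite pk -sumrMnl; apply: le_trans (ler_wMn2r _ (dphase_sum _ _ _)) _.
rewrite -sumrMnl big_seq.
apply: (@le_trans _ _ (\sum_(i <- index_iota k d.+2 | i \in index_iota k d.+2)
    (2 ^ d.+1 * W0 ^ d.+1 * L ^ d.+1)%:R)).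
  apply: ler_sum => i; rewrite mem_index_iota ltnS => /andP[ki id].
  have -> : r`_i *+ 'C(i, k) * (- T%:R) ^+ (i - k) *+ (W * W0 ^ d.+1) =
      (r`_i *+ (W0 ^ i * W)) *+ ('C(i, k) * W0 ^ (d.+1 - i)) * (- T%:R) ^+ (i - k).
    rewrite -mulrnAl -!mulrnA; congr (_ *+ _ * _).
    by rewrite -{1}(subnK id) expnD; ring.
  apply: le_trans (ler_wMn2r _ (dphase_mulXn _ _ _)) _.
  apply: le_trans (ler_wMn2r _ (ler_wMn2r _ (dphaseMn _ _))) _.
  have i0 : (0 < i <= d.+1)%N by rewrite (leq_trans k0 ki).
  apply: (@le_trans _ _ (dphase (r`_i *+ (W0 ^ i * W)) *+ M ^ i *+
     ('C(i, k) * W0 ^ (d.+1 - i) * L ^ (i - k)))).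
    rewrite -!mulrnA; apply: ler_wpMn2l; first exact: dphase_ge0.
    rewrite [X in (_ <= X)%N]mulnCA leq_mul2l; apply/orP; right.
    apply: (@leq_trans ((L * M) ^ (i - k) * M ^ k)).
      by rewrite leq_mul2r leq_expl ?orbT.
    by rewrite expnMn -mulnA -expnD subnK // mulnC.
  apply: le_trans (ler_wMn2r _ (shift _ i0)) _.
  rewrite ler_nat; apply: leq_mul; first apply: leq_mul.
  - apply: (@leq_trans (2 ^ i)); last by rewrite leq_pexp2l.
    exact: bin_le_exp.
  - by rewrite leq_pexp2l // leq_subr.
  - by rewrite leq_pexp2l // (leq_trans (leq_subr _ _)).
rewrite -big_seq sumr_const_seq size_iota -[leLHS]mulr_natl.
rewrite -natrM ler_nat leq_mul2r; apply/orP; right; exact: leq_subr.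
Qed.

(** Times are written [T + W0 * x], with [T] from a long scale that controls
    the leading coefficient and [x] from a shorter one. For fixed [T], the
    leading term moves by a multiple of [p`_d.+1 *+ W0], too little to matter
    at the scale of [x]; what remains is a polynomial in [x] of degree [d], to
    which the induction hypothesis [HX] applies. *)
Lemma all_coef_step d D W0 W K M L (XT X : seq nat) p :
    let M2 := (2 * D * W0 * K * W * M)%N in
    (0 < D)%N -> (0 < M)%N -> (0 < W0)%N -> (0 < W)%N -> (0 < L)%N ->
    (0 < size XT)%N -> (0 < size X)%N ->
    {in X, forall x, (0 < x <= K * M)%N} ->
    {in XT, forall T, (T <= L * M)%N} ->
    (forall q, (size q <= d.+2)%N -> large_expsum D XT (fun t => q.[t%:R]) ->
       dphase (q`_d.+1 *+ W0) *+ M2 ^ d.+1 <= 1) ->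
    (forall q, (size q <= d.+1)%N ->
       large_expsum (2 * D) X (fun t => q.[t%:R]) ->
       forall k, (0 < k <= d)%N -> dphase (q`_k *+ W) *+ M ^ k <= 1) ->
    (size p <= d.+2)%N ->
    large_expsum D [seq (T + W0 * x)%N | T <- XT, x <- X]
      (fun t => p.[t%:R]) ->
  forall k, (0 < k <= d.+1)%N ->
    dphase (p`_k *+ (W * W0 ^ d.+1)) *+ M ^ k <=
    (d.+2 * (2 ^ d.+1 * W0 ^ d.+1 * L ^ d.+1))%:R.
Proof.
move=> M2 D0 M0 W00 Wgt0 L0 XT0 X0 Xle XTle HT HX pd large k kd.
set alpha := p`_d.+1.
have K0 : (0 < K)%N.
  case: (X) X0 Xle => // x s _ /(_ x (mem_head _ _)) /andP[x0].
  by case: (K) => //; rewrite mul0n leqNgt x0.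
have M20 : (0 < M2)%N by rewrite /M2 !muln_gt0 D0 W00 K0 Wgt0 M0.
have ceD : (size XT * size X)%:R <=
    cabs (expsum [seq (T + W0 * x)%N | T <- XT, x <- X]
    (fun t => p.[t%:R])) * D%:R.
  by rewrite mulrC -(size_allpairs (fun T x => T + W0 * x)%N).
have alpha_small : dphase (alpha *+ W0) *+ M2 ^ d.+1 <= 1.
  have [x xX lx] : exists2 x, x \in X &
      large_expsum D XT (fun T => p.[(W0 * x)%:R + T%:R]).
    apply: (large_expsum_fiber _ X0); apply: le_trans ceD _.
    rewrite /expsum big_allpairs_dep exchange_big /= le_eqVlt; apply/orP; left.
    apply/eqP; congr (cabs _ * _); apply: eq_bigr => x _; apply: eq_bigr => T _.
    by rewrite natrD addrC.
  have := HT (poly_shift p (W0 * x)%:R) (leq_trans (size_poly _ _) pd).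
  rewrite /poly_shift coef_poly.
  case: ltnP => [dp|dp]; last first.
    move=> _; rewrite /alpha nth_default // mul0rn dphase0 mul0rn.
    exact: ler01.
  rewrite horner_nderivn_top //; apply; rewrite /large_expsum.
  apply: le_trans lx _; rewrite le_eqVlt; apply/orP; left; apply/eqP.
  by congr (_ * cabs _); apply: eq_bigr => T _;
    rewrite -/(poly_shift _ _) horner_shift.
have [T TX lT] : exists2 T, T \in XT &
    large_expsum D X (fun x => p.[T%:R + (W0 * x)%:R]).
  apply: (large_expsum_fiber _ XT0); rewrite mulnC; apply: le_trans ceD _.
  rewrite /expsum big_allpairs_dep le_eqVlt; apply/orP; left; apply/eqP.
  congr (cabs _ * _); apply: eq_bigr => T _; apply: eq_bigr => x _.
  by rewrite natrD.
apply: (@coef_of_shift d p W W0 M L T k) => //; first exact: XTle.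
set r := poly_shift p _;
  have rd : (size r <= d.+2)%N by exact: leq_trans (size_poly _ _) pd.
have r_top : r`_d.+1 = alpha.
  rewrite /r /poly_shift coef_poly; case: ltnP => dp.
    by rewrite horner_nderivn_top.
  by rewrite /alpha nth_default.
move=> i /andP[i0 id]; move: id; rewrite leq_eqVlt => /orP[/eqP ->|id].
  rewrite r_top expnS -mulnA mulrnA.
  apply: le_trans (ler_wMn2r _ (dphaseMn _ _)) _; rewrite -mulrnA.
  apply: le_trans alpha_small; apply: ler_wpMn2l; first exact: dphase_ge0.
  apply: (@leq_trans ((W0 * W * M) ^ d.+1)).
    rewrite !expnMn leq_mul2r; apply/orP; right; apply: leq_mul.
      by rewrite leq_pexp2l.
    by rewrite -{1}(expn1 W) leq_pexp2l.
  apply: leq_expl; rewrite /M2.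
  have : (0 < 2 * D * K)%N by rewrite !muln_gt0 D0.
  by move: (2 * D)%N => a; nia.
pose q : {poly R} := \poly_(j < d.+1) (r`_j *+ W0 ^ j).
have qi : q`_i = r`_i *+ W0 ^ i by rewrite coef_poly id.
rewrite mulrnA -qi; apply: HX; rewrite ?size_poly ?i0 //.
have qr x : p.[T%:R + (W0 * x)%:R] = q.[x%:R] + alpha *+ W0 *+ (W0 ^ d * x ^ d.+1).
  rewrite -horner_shift -/r (horner_coef_wide _ rd) big_ord_recr /= r_top.
  congr (_ + _).
    rewrite horner_poly; apply: eq_bigr => j _.
    by rewrite natrM exprMn mulrA -[_ *+ W0 ^ j]mulr_natr natrX.
  by rewrite -natrX mulr_natr -[RHS]mulrnA expnMn expnS mulnA.
have err : cabs (expsum X (fun x => p.[T%:R + (W0 * x)%:R])) <=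
           cabs (expsum X (fun x => q.[x%:R])) + (2 * D%:R)^-1 * (size X)%:R.
  rewrite -lerBlDl; apply: le_trans (cabsB _ _) _.
  rewrite /expsum -sumrB; apply: le_trans (cabs_sum _ _) _.
  rewrite mulr_natr -sumr_const_seq big_seq [leRHS]big_seq.
  apply: ler_sum => x xX.
  have -> : phase p.[T%:R + (W0 * x)%:R] - phase q.[x%:R] = phase q.[x%:R] *
      (phase (alpha *+ W0 *+ (W0 ^ d * x ^ d.+1)) - 1).
    by rewrite qr phaseD mulrBr mulr1.
  rewrite cabsM cabs_phase mul1r -/(dphase _).
  rewrite -[leRHS]div1r ler_pdivlMr ?mulr_gt0 ?ltr0n // -natrM mulr_natr.
  apply: le_trans (ler_wMn2r _ (dphaseMn _ _)) _; rewrite -mulrnA.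
  apply: le_trans alpha_small; apply: ler_wpMn2l; first exact: dphase_ge0.
  have /andP[_ xK] := Xle _ xX.
  apply: (@leq_trans ((2 * D * W0 * x) ^ d.+1)).
    rewrite !expnMn mulnC mulnA; apply: leq_mul => //; apply: leq_mul.
      by rewrite -{1}(expn1 (2 * D)) -expnMn leq_pexp2l // muln_gt0 D0.
    by rewrite leq_pexp2l.
  apply: leq_expl; rewrite /M2.
  apply: (@leq_trans (2 * D * W0 * (K * M)));
    first by rewrite leq_mul2l xK orbT.
  by move: (2 * D * W0)%N => a; nia.
rewrite /large_expsum natrM; move: lT; rewrite /large_expsum.
move: err; set A := cabs _; set B := cabs _; set n : R := (size X)%:R.
have D0' : 0 < D%:R :> R by rewrite ltr0n.
move=> /(ler_wpM2l (ltW D0')) err lT; have := le_trans lT err.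
have -> : D%:R * (B + (2 * D%:R)^-1 * n) = D%:R * B + n / 2.
  by field; rewrite gt_eqF.
by rewrite -mulrA; move: (D%:R * B) => z; lra.
Qed.

(** Inverse theorem for Weyl sums, by induction on the degree: [leading_major]
    at a longer scale provides the hypothesis on the leading coefficient in
    [all_coef_step]. *)
Theorem all_major d : exists W K : nat -> nat,
  [/\ tame W, tame K, (forall D, 0 < W D)%N &
      forall D N, (2 <= D)%N -> (0 < N)%N -> exists X,
        [/\ (0 < size X)%N, {in X, forall t, (0 < t <= K D * N)%N} &
            forall p, (size p <= d.+1)%N ->
              large_expsum D X (fun t => p.[t%:R]) ->
              forall k, (0 < k <= d)%N ->
              dphase (p`_k *+ W D) *+ N ^ k <= 1]].
Proof.
elim: d => [|d [W [K [tW tK W0 IH]]]].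
  exists (fun=> 1%N), (fun=> 1%N); split => //; try exact: tame_const.
  move=> D N D2 N0; exists [:: 1%N]; split => //.
    by move=> t; rewrite inE => /eqP ->; rewrite mul1n N0.
  by move=> p _ _ k /andP[k0]; rewrite leqNgt k0.
have [V [L [tV tL V0 top]]] := @leading_major R d.
(* The long scale is [kappa D] times the short one [M]; its times are at most
   [Lam D * M], and passing to [M = C D * N] absorbs the loss in
   [all_coef_step]. *)
pose kappa D := (2 * D * V D * K (2 * D) * W (2 * D))%N.
pose Lam D := (L D * kappa D + 1)%N.
pose C D := (d.+2 * (2 ^ d.+1 * V D ^ d.+1 * Lam D ^ d.+1))%N.
have dbl := double_le_sqr.
have tkappa : tame kappa.
  apply: (tameM _ (tame_comp dbl tW)); apply: (tameM _ (tame_comp dbl tK)).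
  by apply: (tameM _ tV); apply: (tameM (tame_const 2) tame_id).
have tLam : tame Lam by apply: (tameD (tameM tL tkappa)); exact: tame_const.
have tC : tame C.
  apply: (tameM (tame_const _)); apply: (tameM _ (tameX _ tLam)).
  by apply: (tameM (tame_const _)); exact: tameX.
exists (fun D => W (2 * D) * V D ^ d.+1)%N.
exists (fun D => (Lam D + V D * K (2 * D)) * C D)%N; split.
- exact: (tameM (tame_comp dbl tW) (tameX _ tV)).
- by apply: (tameM _ tC); apply: (tameD tLam); apply: (tameM tV);
  exact: tame_comp dbl tK.
- by move=> D; rewrite muln_gt0 W0 expn_gt0 V0.
move=> D N D2 N0; have D0 : (0 < D)%N by apply: ltn_trans D2.
have /andP[E2 _] := dbl _ D2.
have C0 : (0 < C D)%N by rewrite !muln_gt0 !expn_gt0 V0 /Lam addn1.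
pose M := (C D * N)%N; have M0 : (0 < M)%N by rewrite muln_gt0 C0.
have [X [X0 Xle HX]] := IH _ M E2 M0.
have K0 : (0 < K (2 * D))%N.
  case: (X) X0 Xle => // x s _ /(_ x (mem_head _ _)) /andP[x0].
  by case: (K _) => //; rewrite mul0n leqNgt x0.
have M20 : (0 < kappa D * M)%N.
  by rewrite muln_gt0 M0 andbT !muln_gt0 D0 V0 K0 W0.
have [XT [XT0 XTle HT]] := top _ _ D2 M20.
exists [seq (T + V D * x)%N | T <- XT, x <- X]; split.
- by rewrite size_allpairs muln_gt0 XT0.
- move=> _ /allpairsP[[T x] /= [TX xX ->]].
  have /andP[T0 TL] := XTle _ TX; have /andP[_ xK] := Xle _ xX.
  rewrite addn_gt0 T0 /= -mulnA -/M mulnDl leq_add //.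
    by apply: leq_trans TL _; rewrite mulnA leq_mul2r leq_addr orbT.
  by rewrite -mulnA leq_mul2l xK orbT.
move=> p pd large k kd.
have := @all_coef_step d D (V D) (W (2 * D)) (K (2 * D)) M (Lam D) XT X p D0 M0
  (V0 _) (W0 _) _ XT0 X0 Xle _ HT HX pd large k kd.
have le1 : {in XT, forall T, (T <= Lam D * M)%N}.
  move=> T /XTle /andP[_ /leq_trans]; apply.
  by rewrite mulnA leq_mul2r leq_addr orbT.
rewrite {1}/Lam addn1 => /(_ isT le1); rewrite -/(C D).
have C0' : 0 < (C D)%:R :> R by rewrite ltr0n.
move=> small; rewrite -(ler_pM2l C0') mulr1; apply: le_trans small.
have -> (a : R) b c : c%:R * (a *+ b) = a *+ (c * b).
  by rewrite -[a *+ b]mulr_natr mulrCA -natrM mulr_natr.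
apply: ler_wpMn2l; first exact: dphase_ge0.
rewrite /M expnMn leq_mul2r; apply/orP; right.
by case/andP: kd => k0 _; rewrite -{1}(expn1 (C D)) leq_pexp2l.
Qed.

End AllCoefficients.

(** * A finite polynomial van der Corput set *)

Section VanDerCorputSet.
Context {R : realType}.
Implicit Types (p q : {poly R}) (X Y : seq nat).

Definition avgRe X (f : nat -> R) : R :=
  complex.Re (expsum X f) / (size X)%:R.

Lemma avgRe_ge X f (c : R) : (0 < size X)%N ->
  (forall t, t \in X -> c <= complex.Re (phase (f t))) -> c <= avgRe X f.
Proof.
move=> X0 cf; rewrite /avgRe ler_pdivlMr ?ltr0n // mulr_natr -sumr_const_seq.
rewrite /expsum Re_sum big_seq [leRHS]big_seq.
by apply: ler_sum => t tX; exact: cf.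
Qed.

Lemma avgRe_geN1 X f : (0 < size X)%N -> -1 <= avgRe X f.
Proof.
move=> X0; apply: avgRe_ge => // t _.
by have := Re_phase_ge (f t); have := dphase_le2 (f t); lra.
Qed.

Lemma avgRe_small D X f : (0 < D)%N -> (0 < size X)%N ->
  ~ large_expsum D X f -> - D%:R^-1 <= avgRe X f.
Proof.
move=> D0 X0 /negP; rewrite -ltNge => small.
rewrite /avgRe ler_pdivlMr ?ltr0n // mulNr lerNl mulrC ler_pdivlMr ?ltr0n //.
apply: le_trans (ltW small); rewrite mulrC; apply: ler_wpM2l => //.
by apply: le_trans (Re_le_cabs _); rewrite -normrN ler_norm.
Qed.

Definition poly_dilate p (c : nat) : {poly R} :=
  \poly_(i < size p) (p`_i *+ c ^ i).

Lemma coef_dilate p c i : (poly_dilate p c)`_i = p`_i *+ c ^ i.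
Proof.
by rewrite coef_poly; case: ltnP => // pi; rewrite nth_default // mul0rn.
Qed.

Lemma horner_dilate p c (t : nat) : (poly_dilate p c).[t%:R] = p.[(c * t)%:R].
Proof.
rewrite horner_poly horner_coef; apply: eq_bigr => i _.
by rewrite natrM exprMn mulrA -[_ *+ c ^ i]mulr_natr natrX.
Qed.

Lemma dphase_horner_le d p (t : nat) : (size p <= d.+1)%N -> p`_0 = 0 ->
  (forall k, (0 < k <= d)%N -> dphase (p`_k *+ t ^ k) *+ d.+1 <= 1) ->
  dphase p.[t%:R] <= 1.
Proof.
move=> pd p0 small; rewrite (horner_coef_wide _ pd).
apply: le_trans (dphase_sum _ _ _) _.
have d0 : 0 < d.+1%:R :> R by rewrite ltr0n.
rewrite -(ler_pM2r d0) mul1r mulr_suml.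
rewrite -[X in _ <= X%:R]card_ord -sumr_const; apply: ler_sum => k _.
rewrite -natrX !mulr_natr; case: (posnP k) => [->|k0].
  by rewrite p0 mul0rn dphase0 mul0rn ler01.
by apply: small; rewrite k0 -ltnS ltn_ord.
Qed.

(** If the coefficients of [p] are nearly rational at the scale [N'], then [p]
    is nearly integral on the multiples of a higher power of [W] that are much
    smaller than [N'], as the denominators then divide the times. *)
Lemma scales_separated d p (W K J i j N N' t : nat) :
    (0 < W)%N -> (i < j < J)%N -> (size p <= d.+1)%N -> p`_0 = 0 ->
    (forall k, (0 < k <= d)%N ->
       dphase ((poly_dilate p (W ^ (J - j)))`_k *+ W) *+ N' ^ k <= 1) ->
    (t <= K * N)%N -> (d.+1 * W ^ J * (K * N) <= N')%N ->
  dphase p.[(W ^ (J - i) * t)%:R] <= 1.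
Proof.
move=> W0 /andP[ij jJ] pd p0 small tK NN'.
apply: (dphase_horner_le pd p0) => k kd; have /andP[k0 _] := kd.
have -> : p`_k *+ (W ^ (J - i) * t) ^ k =
    (poly_dilate p (W ^ (J - j)))`_k *+ W *+ (W ^ ((j - i) * k).-1 * t ^ k).
  rewrite coef_dilate -!mulrnA; congr (_ *+ _).
  rewrite expnMn !mulnA; congr (_ * _)%N; rewrite -!expnM -expnSr -expnD.
  have ijk : (0 < (j - i) * k)%N by rewrite muln_gt0 subn_gt0 ij.
  congr (_ ^ _)%N; rewrite addSnnS prednK // -mulnDl; congr (_ * _)%N.
  by lia.
apply: le_trans (ler_wMn2r _ (dphaseMn _ _)) _; rewrite -mulrnA.
apply: le_trans (small _ kd); apply: ler_wpMn2l; first exact: dphase_ge0.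
apply: leq_trans (leq_expl k NN'); rewrite !expnMn mulnC mulnA.
apply: leq_mul; last by rewrite -expnMn leq_expl.
apply: leq_mul; first by rewrite -{1}(expn1 d.+1) leq_pexp2l.
rewrite -expnM leq_pexp2l //; apply: (leq_trans (leq_pred _)).
by rewrite leq_mul2r; apply/orP; right; lia.
Qed.

(** The members of [XX] live at [2 * D] scales, separated so much that for each
    polynomial only one scale is exceptional. Let [m] be the largest scale at
    which [p] has a large sum. Above [m] the averages are small; below [m] the
    values of [p] are, by [scales_separated], close enough to integers for the
    averages to be nonnegative. The scale [m] itself costs at most [1] out of
    [2 * D]. *)
Theorem polynomial_vdc d : exists2 N : nat -> nat, tame N &
  forall D, (2 <= D)%N -> exists XX : seq (seq nat),
    [/\ (0 < size XX)%N,
        forall X, X \in XX -> (0 < size X)%N,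
        forall X t, X \in XX -> t \in X -> (0 < t <= N D)%N &
        forall p, (size p <= d.+1)%N -> p`_0 = 0 ->
          - (size XX)%:R <= D%:R * \sum_(X <- XX) avgRe X (fun t => p.[t%:R])].
Proof.
have [W [K [tW tK W0 main]]] := @all_major R d.
(* [T D] is the ratio of consecutive scales. *)
pose T D := (d.+1 * W (2 * D) ^ (2 * D) * (K (2 * D) + 1))%N.
have dbl := double_le_sqr.
have dbl' D : (2 <= D -> 2 * D <= D ^ 2)%N by move=> /dbl /andP[].
have tWJ : tame (fun D => W (2 * D) ^ (2 * D))%N.
  exact: (tame_expn dbl' (tame_comp dbl tW)).
have tT : tame T.
  apply: (tameM (tameM (tame_const _) tWJ)).
  exact: (tameD (tame_comp dbl tK) (tame_const 1)).
exists (fun D => W (2 * D) ^ (2 * D) * (K (2 * D) * T D ^ (2 * D)))%N.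
  by apply: (tameM tWJ); apply: (tameM (tame_comp dbl tK));
    exact: (tame_expn dbl' tT).
move=> D D2; have D0 : (0 < D)%N by apply: ltn_trans D2.
have /andP[E2 _] := dbl _ D2; set J := (2 * D)%N in E2 *.
have T0 : (0 < T D)%N by rewrite /T addn1 !muln_gt0 expn_gt0 W0.
have /choice[X_ HX] : forall j, exists X,
        [/\ (0 < size X)%N, {in X, forall t, (0 < t <= K J * T D ^ j)%N} &
            forall p, (size p <= d.+1)%N ->
              large_expsum J X (fun t => p.[t%:R]) ->
              forall k, (0 < k <= d)%N ->
              dphase (p`_k *+ W J) *+ (T D ^ j) ^ k <= 1].
  by move=> j; apply: main => //; rewrite expn_gt0 T0.
(* The times at scale [j] are multiples of [q j]; passing to a smaller scale
   brings in one more factor [W J], which clears the denominator. *)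
pose q j := (W J ^ (J - j))%N.
have q0 j : (0 < q j)%N by rewrite expn_gt0 W0.
exists [seq [seq (q j * t)%N | t <- X_ j] | j <- iota 0 J]; split.
- by rewrite size_map size_iota /J muln_gt0 D0.
- by move=> _ /mapP[j _ ->]; rewrite size_map; have [] := HX j.
- move=> _ t /mapP[j jJ ->] /mapP[s sX ->];
  have [_ /(_ _ sX)/andP[s0 sK] _] := HX j.
  rewrite muln_gt0 q0 s0 /=; apply: leq_mul.
    by rewrite leq_pexp2l // leq_subr.
  apply: leq_trans sK _; rewrite leq_mul2l; apply/orP; right.
  by move: jJ; rewrite mem_iota => /andP[_ /ltnW jJ]; rewrite leq_pexp2l.
move=> p pd p0; rewrite size_map size_iota big_map.
pose a j := avgRe [seq (q j * t)%N | t <- X_ j] (fun t => p.[t%:R]).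
rewrite (eq_bigr a) //.
have aE j : a j = avgRe (X_ j) (fun t => (poly_dilate p (q j)).[t%:R]).
  rewrite /a /avgRe size_map /expsum big_map; congr (complex.Re _ / _).
  by apply: eq_bigr => t _; rewrite horner_dilate.
have pjd j : (size (poly_dilate p (q j)) <= d.+1)%N.
  by apply: leq_trans (size_poly _ _) pd.
pose bad j := (j < J)%N &&
  `[< large_expsum J (X_ j) (fun t => (poly_dilate p (q j)).[t%:R]) >].
have [m mP] : exists m, forall j, (j < J)%N -> - J%:R^-1 - (j == m)%:R <= a j.
  have good j : (j < J)%N -> ~~ bad j -> - J%:R^-1 <= a j.
    rewrite /bad => -> /= /asboolPn nl; rewrite aE; have [X0 _ _] := HX j.
    by apply: avgRe_small => //; rewrite /J muln_gt0 D0.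
  have J0 : 0 <= J%:R^-1 :> R by rewrite invr_ge0.
  have [exbad|nobad] := pselect (exists j, bad j); last first.
    exists 0%N => j jJ; have : - J%:R^-1 <= a j.
      by apply: good => //; apply/negP => bj; apply: nobad; exists j.
    by have : 0 <= (j == 0%N)%:R :> R by []; lra.
  have ubad j : bad j -> (j <= J)%N by case/andP => /ltnW.
  case: (ex_maxnP exbad ubad) => m /andP[mJ /asboolP lm] mmax.
  exists m => j jJ; case: (ltngtP j m) => [jm|mj|->].
  - have [X0 Xle _] := HX j; have [_ _ /(_ _ (pjd m) lm) small] := HX m.
    suff : 0 <= a j by rewrite subr0; lra.
    rewrite aE; apply: avgRe_ge => // t tX; rewrite horner_dilate.
    have /andP[_ tK'] := Xle _ tX.
    suff : dphase p.[(q j * t)%:R] <= 1.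
      by have := Re_phase_ge p.[(q j * t)%:R]; lra.
    apply: (@scales_separated d p (W J) (K J) J j m (T D ^ j) (T D ^ m)) => //.
      by rewrite jm.
    apply: (@leq_trans (T D ^ j.+1)); last by rewrite leq_pexp2l.
    rewrite expnS mulnA leq_mul2r /T; apply/orP; right.
    by rewrite leq_mul2l leq_addr orbT.
  - rewrite subr0; apply: good => //; apply/negP => /mmax.
    by rewrite leqNgt mj.
  - have [X0 _ _] := HX m; apply: (@le_trans _ _ (-1)).
      by rewrite mulr1n; lra.
    by rewrite aE avgRe_geN1.
have : \sum_(j <- iota 0 J) (- J%:R^-1 - (j == m)%:R) <= \sum_(j <- iota 0 J) a j.
  rewrite big_seq [leRHS]big_seq; apply: ler_sum => j.
  by rewrite mem_iota => /andP[_ jJ]; apply: mP.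
rewrite sumrB sumr_const_seq size_iota.
have J0 : J%:R != 0 :> R by rewrite pnatr_eq0 -lt0n /J muln_gt0 D0.
have -> : - J%:R^-1 *+ J = -1 :> R by rewrite -[LHS]mulr_natr mulNr mulVf.
have : \sum_(j <- iota 0 J) (j == m)%:R <= 1 :> R.
  rewrite -natr_sum lern1; have := count_uniq_mem m (iota_uniq 0 J).
  rewrite -sum1_count big_mkcond => ->; exact: leq_b1.
set s := \sum_(j <- _) _; set b := \sum_(j <- _) _ => s1 hb.
have : D%:R * (- 2) <= D%:R * b :> R by apply: ler_wpM2l => //; lra.
by apply: le_trans; rewrite mulrN lerN2 -natrM mulnC.
Qed.

End VanDerCorputSet.

(** * Recurrence in the group (Z/M)^d *)

Section Fourier.
Context {R : realType}.
Implicit Types (X Y : seq nat).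

Lemma phase_sum (I : Type) (s : seq I) (F : I -> R) :
  phase (\sum_(i <- s) F i) = \prod_(i <- s) phase (F i).
Proof. exact: (big_morph _ phaseD phase0). Qed.

Lemma phase_neq1 (M r : nat) : (0 < r < M)%N -> phase (r%:R / M%:R : R) != 1.
Proof.
move=> /andP[r0 rM]; apply/negP => /eqP/(congr1 (@complex.Re R)) /=.
have Mn0 : (0 < M)%N by exact: leq_trans rM.
have M0 : 0 < M%:R :> R by rewrite ltr0n.
rewrite -mulrA mulr_natl; set th := pi * _; rewrite cos_mulr2n => h.
have sin_th_gt0 : 0 < sin th.
  apply: sin_gt0_pi; rewrite mulr_gt0 ?pi_gt0 ?divr_gt0 ?ltr0n //=.
  by rewrite -[ltRHS]mulr1 ltr_pM2l ?pi_gt0 // ltr_pdivrMr // mul1r ltr_nat.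
have := cos2Dsin2 th; have : 0 < sin th ^+ 2 by exact: exprn_gt0.
move: h; rewrite -[_ *+ 2]mulr_natr; lra.
Qed.

Lemma phase_div_neq1 (M a b : nat) : (0 < M)%N -> a != b %[mod M] ->
  phase (a%:R / M%:R - b%:R / M%:R : R) != 1.
Proof.
move=> M0; wlog ba : a b / (b <= a)%N.
  move=> wlg neq; case: (leqP b a) => [|/ltnW] ba; first exact: wlg.
  have neq' : b != a %[mod M] by rewrite eq_sym.
  apply: contra (wlg _ _ ba neq') => /eqP e1.
  by rewrite -opprB phaseN e1 rmorph1.
rewrite eqn_mod_dvd // => ndvd.
rewrite -mulrBl -natrB // (divn_eq (a - b) M) natrD mulrDl natrM mulfK;
  last first.
  by rewrite pnatr_eq0 -lt0n.
rewrite phaseD phase_nat mul1r; apply: phase_neq1.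
by rewrite ltn_mod M0 lt0n andbT.
Qed.

Lemma sum_phase_eq0 (M a b : nat) : (0 < M)%N -> a != b %[mod M] ->
  \sum_(x < M) phase (x%:R * a%:R / M%:R - x%:R * b%:R / M%:R : R) = 0.
Proof.
move=> M0 /(phase_div_neq1 M0); set w := phase _ => w1.
have -> : \sum_(x < M) phase (x%:R * a%:R / M%:R - x%:R * b%:R / M%:R : R) =
          \sum_(x < M) w ^+ x.
  apply: eq_bigr => x _; rewrite -phaseMn; congr phase.
  by rewrite -[RHS]mulr_natl mulrBr !mulrA.
have wM : w ^+ M = 1.
  rewrite -phaseMn -[_ *+ M]mulr_natr mulrBl !divfK ?pnatr_eq0 -?lt0n //.
  by rewrite phaseB !phase_nat rmorph1 mulr1.
apply/eqP; have /eqP := subrX1 w M; rewrite wM subrr eq_sym mulf_eq0 subr_eq0.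
by rewrite (negbTE w1).
Qed.

Section Group.
Variables (d M : nat).
Hypothesis M0 : (0 < M)%N.
Notation G := {ffun 'I_d -> 'I_M}.
Implicit Types (xi k : G) (y : 'I_d -> nat) (A : {set G}).

Definition pairing xi y : R := \sum_i (xi i)%:R * (y i)%:R / M%:R.

Definition fourier A xi : R[i] :=
  \sum_(k in A) phase (pairing xi (fun i => k i)).

(** Up to the factor [M ^ d], the right-hand side counts the pairs of points of
    [A] whose difference is [y], by orthogonality of characters. *)
Lemma sum_fourier_sqr A y :
  \sum_(xi : G) (cabs (fourier A xi) ^+ 2)%:C%C * phase (pairing xi y) =
  \sum_(k in A) \sum_(k' in A) \prod_i \sum_(x < M)
    phase (x%:R * (k i + y i)%:R / M%:R - x%:R * (k' i)%:R / M%:R : R).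
Proof.
transitivity (\sum_(xi : G) \sum_(k in A) \sum_(k' in A) \prod_i
    phase ((xi i)%:R * (k i + y i)%:R / M%:R - (xi i)%:R * (k' i)%:R / M%:R : R)).
  apply: eq_bigr => xi _; rewrite -cabs_sqr /fourier rmorph_sum !mulr_suml.
  apply: eq_bigr => k _; rewrite mulr_sumr mulr_suml; apply: eq_bigr => k' _.
  rewrite -phaseB -phaseD -phase_sum /pairing -sumrB -big_split /=; congr phase.
  by apply: eq_bigr => i _; rewrite natrD; ring.
rewrite exchange_big; apply: eq_bigr => k _; rewrite exchange_big.
by apply: eq_bigr => k' _; rewrite bigA_distr_bigA.
Qed.

Lemma sum_fourier_eq0 A y :
  (forall k k', k \in A -> k' \in A -> exists i, k i + y i != k' i %[mod M]) ->
  \sum_(xi : G) (cabs (fourier A xi) ^+ 2)%:C%C * phase (pairing xi y) = 0.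
Proof.
move=> no; rewrite sum_fourier_sqr big1 // => k kA; rewrite big1 // => k' k'A.
by have [i ki] := no _ _ kA k'A; rewrite (bigD1 i) //= sum_phase_eq0 // mul0r.
Qed.

Lemma parseval A :
  \sum_(xi : G) cabs (fourier A xi) ^+ 2 = (M ^ d)%:R * #|A|%:R.
Proof.
apply: (@complexI R); rewrite rmorph_sum rmorphM /= !rmorph_nat.
transitivity (\sum_(xi : G) (cabs (fourier A xi) ^+ 2)%:C%C *
                phase (pairing xi (fun=> 0%N))).
  apply: eq_bigr => xi _.
  by rewrite /pairing big1 ?phase0 ?mulr1 // => i _; rewrite mulr0 mul0r.
rewrite sum_fourier_sqr; rewrite -sum1_card natr_sum mulr_sumr;
  apply: eq_bigr => k kA.
rewrite (bigD1 k) //= [X in _ + X]big1 ?addr0 => [|k' /andP[_ kk']]; last first.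
  have [i ki] : exists i, k i != k' i.
    apply/existsP; apply: contraNT kk'; rewrite negb_exists => /forallP eqk.
    by apply/eqP/ffunP => i; move: (eqk i); rewrite negbK => /eqP.
  rewrite (bigD1 i) //= sum_phase_eq0 ?mul0r // addn0 !modn_small //.
rewrite mulr1 -[X in (_ ^ X)%:R]card_ord natrX -prodr_const;
  apply: eq_bigr => i _.
under eq_bigr do rewrite addn0 subrr phase0.
by rewrite sumr_const card_ord.
Qed.

End Group.

(** The polynomial whose values at integers are the phases of the character
    [xi] along the integer curve. *)
Definition freq_poly d M (xi : {ffun 'I_d -> 'I_M}) (b : 'I_d -> nat) :
    {poly R} :=
  \sum_i ((xi i)%:R * (b i)%:R / M%:R) *: 'X^(i.+1).

Lemma size_freq_poly d M (xi : {ffun 'I_d -> 'I_M}) b :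
  (size (freq_poly xi b) <= d.+1)%N.
Proof.
apply: (leq_trans (size_sum _ _ _)); apply/bigmax_leqP => i _.
by rewrite (leq_trans (size_scale_leq _ _)) // size_polyXn ltnS.
Qed.

Lemma coef0_freq_poly d M (xi : {ffun 'I_d -> 'I_M}) b : (freq_poly xi b)`_0 = 0.
Proof. by rewrite coef_sum big1 // => i _; rewrite coefZ coefXn mulr0. Qed.

Lemma horner_freq_poly d M (xi : {ffun 'I_d -> 'I_M}) b (t : nat) :
  (freq_poly xi b).[t%:R] = pairing xi (fun i => b i * t ^ i.+1)%N :> R.
Proof.
rewrite horner_sum; apply: eq_bigr => i _.
by rewrite hornerZ hornerXn natrM natrX; ring.
Qed.

Lemma sum_avgRe_eq0 d M (A : {set {ffun 'I_d -> 'I_M}}) b X : (0 < M)%N ->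
    (forall t k k', t \in X -> k \in A -> k' \in A ->
       exists i, k i + b i * t ^ i.+1 != k' i %[mod M]) ->
  \sum_(xi : {ffun 'I_d -> 'I_M}) cabs (@fourier d M A xi) ^+ 2 *
    avgRe X (fun t => (freq_poly xi b).[t%:R]) = 0.
Proof.
move=> M0 no; rewrite /avgRe.
under eq_bigr do rewrite mulrA /expsum Re_sum mulr_sumr.
rewrite -mulr_suml exchange_big /= big1_seq ?mul0r // => t /andP[_ tX].
transitivity (complex.Re (\sum_(xi : {ffun 'I_d -> 'I_M})
    (cabs (@fourier d M A xi) ^+ 2)%:C%C *
    phase (pairing xi (fun i => b i * t ^ i.+1)%N))).
  by rewrite Re_sum; apply: eq_bigr => xi _; rewrite Re_realM horner_freq_poly.
by rewrite sum_fourier_eq0 // => k k'; exact: no.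
Qed.

(** If no pair existed, the sum over [xi] of [|fourier A xi| ^ 2] times the
    averages of [polynomial_vdc] would vanish. The trivial character
    contributes [#|A| ^ 2] to it, and by Parseval the other ones at least [- M
    ^ d * #|A| / D]. *)
Theorem discrete_recurrence d : exists2 N : nat -> nat, tame N &
  forall D M (b : 'I_d -> nat) (A : {set {ffun 'I_d -> 'I_M}}),
    (2 <= D)%N -> (0 < M)%N -> (M ^ d < D * #|A|)%N ->
  exists t k k', [/\ (0 < t <= N D)%N, k \in A, k' \in A &
    forall i, (k' i = k i + b i * t ^ i.+1 %[mod M])%N].
Proof.
have [N tN vdc] := @polynomial_vdc R d; exists N => // D M b A D2 M0 dense.
have [XX [XX0 Xne Xle pos]] := vdc _ D2.
apply: contrapT => none.
pose w (xi : {ffun 'I_d -> 'I_M}) : R := cabs (@fourier d M A xi) ^+ 2.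
pose g (xi : {ffun 'I_d -> 'I_M}) : R := D%:R *
  \sum_(X <- XX) avgRe X (fun t => (freq_poly xi b).[t%:R]).
have sum0 : \sum_xi w xi * g xi = 0.
  under eq_bigr do rewrite /g mulrCA mulr_sumr.
  rewrite -mulr_sumr exchange_big /= big1_seq ?mulr0 // => X /andP[_ XXX].
  apply: sum_avgRe_eq0 => // t k k' tX kA k'A; apply: contrapT => eqk.
  apply: none; exists t, k, k'; split => //; first exact: Xle XXX tX.
  move=> i; apply/eqP; rewrite eq_sym; apply: contraT => neq.
  by case: eqk; exists i.
pose z : {ffun 'I_d -> 'I_M} := [ffun=> Ordinal M0].
have z0 (y : 'I_d -> nat) : pairing z y = 0 :> R.
  by rewrite /pairing big1 // => i _; rewrite ffunE !mul0r.
have gz : g z = D%:R * (size XX)%:R.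
  rewrite /g; congr (_ * _); rewrite -[RHS]mulr1 mulr_natl -sumr_const_seq.
  rewrite big_seq [RHS]big_seq; apply: eq_bigr => X XXX.
  rewrite /avgRe /expsum Re_sum.
  under eq_bigr do rewrite horner_freq_poly z0 phase0.
  by rewrite sumr_const_seq divff // pnatr_eq0 -lt0n Xne.
have wz : w z = #|A|%:R ^+ 2.
  rewrite /w /fourier; under eq_bigr do rewrite z0 phase0.
  by rewrite sumr_const cabs_nat.
have A0 : (0 < #|A|)%N by move: dense; case: #|A| => //; rewrite muln0.
have := parseval M0 A; rewrite -/w.
rewrite (bigD1 z) //= -/(w z) => pars.
move: sum0; rewrite (bigD1 z) //= gz => sum0.
have : - (size XX)%:R * \sum_(i | i != z) w i <= \sum_(i | i != z) w i * g i.
  rewrite mulr_sumr; apply: ler_sum => xi _; rewrite mulrC.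
  apply: ler_wpM2l; first exact: sqr_ge0.
  by apply: pos; [exact: size_freq_poly|exact: coef0_freq_poly].
move: sum0 pars; rewrite wz.
have : (M ^ d)%:R < D%:R * #|A|%:R :> R by rewrite -natrM ltr_nat.
have J0 : 0 < (size XX)%:R :> R by rewrite ltr0n.
have a0 : 0 < #|A|%:R :> R by rewrite ltr0n.
set a : R := #|A|%:R; set m : R := (_ ^ _)%:R; set J : R := (size XX)%:R.
set S := (\sum_(i | _) w i * g i); set T := (\sum_(i | _) w i).
move=> dense' sum0 pars low.
have TE : T = m * a - a ^+ 2.
  by rewrite -pars /T /w addrC addrK.
have : J * (a * (D%:R * a - m)) + J * a ^+ 2 <= 0.
  suff -> : J * (a * (D%:R * a - m)) + J * a ^+ 2 = - J * T - S by rewrite subr_le0.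
  have -> : S = - (a ^+ 2 * (D%:R * J)).
    by apply/eqP; rewrite -addr_eq0 addrC sum0.
  by rewrite TE; ring.
by apply/negP; rewrite -ltNge addr_gt0 ?mulr_gt0 ?exprn_gt0 ?subr_gt0.
Qed.

End Fourier.

(** * Lebesgue measure and translations *)

Local Open Scope classical_set_scope.

Section Measure.
Context {R : realType}.
Local Open Scope ereal_scope.

(** The type annotations select the Borel structure on the line. *)
Definition shift_line (a : R) (x : measurableTypeR R) : measurableTypeR R :=
  (x + a)%R.

Lemma measurable_shift_line a : measurable_fun setT (shift_line a).
Proof. exact: measurable_funD. Qed.

Definition translated_lebesgue a :
    {measure set (measurableTypeR R) -> \bar R} :=
  measure_function_pushforward__canonical__measure_function_Measure
    lebesgue_measure (measurable_shift_line a).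

Lemma translated_lebesgueE a (A : set (measurableTypeR R)) : measurable A ->
  translated_lebesgue a A = lebesgue_measure A.
Proof.
move=> mA; apply/esym; move: A mA.
apply: (@lebesgue_measure_unique R (translated_lebesgue a)) => _ [[u v]] _ <-.
rewrite -[RHS]/(lebesgue_measure (shift_line a @^-1` `]u, v])).
rewrite (_ : shift_line a @^-1` _ = `](u - a)%R, (v - a)%R]); last first.
  by apply/seteqP; split => x /=; rewrite !in_itv /= ltrBlDr lerBrDr.
rewrite /= !lebesgue_measure_itv /= !lte_fin ltrD2r; case: ifP => // _.
by rewrite -!EFinB; congr (_%:E); ring.
Qed.

Lemma ge0_integral_translate a (f : measurableTypeR R -> \bar R) :
  measurable_fun setT f -> (forall x, 0 <= f x) ->
  \int[lebesgue_measure]_x f (x + a)%R = \int[lebesgue_measure]_x f x.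
Proof.
move=> mf f0; transitivity (\int[translated_lebesgue a]_x f x).
  exact/esym/(ge0_integral_pushforward (measurable_shift_line a)).
apply: (@eq_measure_integral _ _ R setT lebesgue_measure (translated_lebesgue a)).
by move=> A mA _; exact: translated_lebesgueE.
Qed.

Lemma measurable_tuple_add n (y : n.-tuple R) :
  measurable_fun setT (fun x : euclid R n => tuple_add x y : euclid R n).
Proof.
apply/measurable_fun_tnthP => i.
rewrite (_ : _ \o _ = fun x : euclid R n => (tnth x i + tnth y i)%R);
  last first.
  by apply/funext => x /=; rewrite tnth_mktuple.
by apply: measurable_funD => //; exact: measurable_tnth.
Qed.

Lemma tuple_add_cons n (x : R) (t : n.-tuple R) (y : n.+1.-tuple R) :
  tuple_add (cons_pair (x, t)) y =
  cons_pair (x + thead y, tuple_add t [tuple of behead y])%R.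
Proof.
apply: eq_from_tnth => i; rewrite tnth_mktuple.
case: (unliftP ord0 i) => [j|] -> /=; last by rewrite !tnth0.
rewrite !tnthS tnth_mktuple; congr (_ + _)%R.
by rewrite [in LHS](tuple_eta y) tnthS.
Qed.

Lemma borel_lebesgue_translate n (y : n.-tuple R) (A : set (euclid R n)) :
  measurable A ->
  borel_lebesgue [set x : euclid R n | A (tuple_add x y)] = borel_lebesgue A.
Proof.
elim: n y A => [|n IH] y A mA.
  have fix0 (x : 0.-tuple R) : tuple_add x y = x by rewrite [RHS]tuple0 tuple0.
  by congr borel_lebesgue; apply/seteqP; split => x /=; rewrite fix0.
rewrite /= /pushforward /product_measure1 /=.
have mA' : measurable (@cons_pair R n @^-1` A).
  by rewrite -[X in measurable X]setTI; exact: measurable_cons_pair.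
rewrite -[RHS](ge0_integral_translate (thead y)).
- apply: eq_integral => x _ /=.
  rewrite -[RHS](IH [tuple of behead y]); last exact: measurable_xsection.
  congr borel_lebesgue; apply/seteqP; split => t;
    by rewrite /xsection /= !inE /= tuple_add_cons.
- exact: measurable_fun_xsection.
- by move=> x; exact: measure_ge0.
Qed.

Lemma unit_cube_box n : unit_cube n = [set x : euclid R n |
  forall i, (tnth [tuple 0 | i < n] i <= tnth x i <= tnth [tuple 1 | i < n] i)%R].
Proof.
by apply/seteqP; split => x /= h i; have := h i; rewrite !tnth_mktuple.
Qed.

Lemma measurable_unit_cube n : measurable (unit_cube n : set (euclid R n)).
Proof. by rewrite unit_cube_box; exact: measurable_box. Qed.

Lemma borel_lebesgue_unit_cube n :
  borel_lebesgue (unit_cube n : set (euclid R n)) = 1.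
Proof.
rewrite unit_cube_box borel_lebesgue_box => [|i]; last first.
  by rewrite !tnth_mktuple ler01.
by rewrite big1 // => i _; rewrite !tnth_mktuple subr0.
Qed.

(** Half of the measure of [E] is enough, so the inner set is the complement in
    the cube of a measurable cover of the rest of the cube. *)
Lemma inner_borel n (E : set (n.-tuple R)) (eps : R) :
    (0 < eps)%R -> lebesgue_measurable E -> E `<=` unit_cube n ->
    eps%:E <= lebesgue_vol E ->
  exists A : set (euclid R n),
    [/\ measurable A, A `<=` E & (eps / 2)%:E <= borel_lebesgue A].
Proof.
move=> eps0 mE Ecube volE.
pose mu : {measure set (euclid R n) -> \bar R} := @borel_lebesgue R n.
pose Q : set (euclid R n) := unit_cube n.
have mQ : measurable Q by exact: measurable_unit_cube.
have split_Q : 1 = lebesgue_vol E + (mu^*)%mu (Q `\` E).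
  rewrite -(borel_lebesgue_unit_cube n) -[LHS](lebesgue_vol_borel mQ).
  rewrite [LHS](mE Q) setDE; congr (_ + _).
  by congr ((mu^*)%mu _); apply/setIidPr; exact: Ecube.
have vol0 : 0 <= lebesgue_vol E by exact: mu_ext_ge0.
have rest0 : 0 <= (mu^*)%mu (Q `\` E) by exact: mu_ext_ge0.
have rest_fin : (mu^*)%mu (Q `\` E) \is a fin_num.
  rewrite ge0_fin_numE // (@le_lt_trans _ _ 1) ?ltry //.
  by rewrite [leRHS]split_Q leeDr.
have vol_fin : lebesgue_vol E \is a fin_num.
  rewrite ge0_fin_numE // (@le_lt_trans _ _ 1) ?ltry //.
  by rewrite [leRHS]split_Q leeDl.
have eps2 : (0 < eps / 2)%R by rewrite divr_gt0.
have [_ [F [mF QF] <-] sumF] := lb_ereal_inf_adherent eps2 rest_fin.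
pose G := \bigcup_k F k.
have mG : measurable G by exact: bigcupT_measurable.
exists (Q `\` G); split; first exact: measurableD.
  move=> x [Qx nGx]; apply: contrapT => nEx; apply: nGx; exact: QF.
have mQG : measurable (Q `\` G) by exact: measurableD.
have muG : mu G <= (mu^*)%mu (Q `\` E) + (eps / 2)%:E.
  apply: le_trans (ltW sumF).
  exact: measure_sigma_subadditive.
have cover : 1 <= mu (Q `\` G) + mu G.
  rewrite -(borel_lebesgue_unit_cube n) -/mu.
  apply: (@le_trans _ _ (mu ((Q `\` G) `|` G))).
    apply: le_measure; rewrite ?inE //; first exact: measurableU.
    by move=> x Qx; have [Gx|nGx] := pselect (G x); [right|left].
  by apply: measureU2.
move: volE split_Q muG cover; rewrite -[borel_lebesgue _]/(mu (Q `\` G)).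
move: rest_fin vol_fin => /fineK <- /fineK <-.
move: (fine _) (fine _) => r v; rewrite lee_fin => ev.
case => rv muG cover.
have : 1 <= mu (Q `\` G) + (r%:E + (eps / 2)%:E) by apply: le_trans cover _;
  exact: leeD2l.
rewrite -EFinD; move: (measure_ge0 mu (Q `\` G)); case: (mu _) => [a| |] //=.
  by rewrite -EFinD !lee_fin; move: rv ev; clear=> rv ev _ ar; lra.
by move=> _ _; rewrite leey.
Qed.

(** Fubini for a finite set of translations: all translates of [A] lie in a
    cube of side [1 + B + B], and the integral over this cube of the number of
    [i] with [x + w i] in [A] is [#|I|] times the measure of [A]. *)
Lemma translate_average n (A : set (euclid R n)) (I : finType)
    (w : I -> n.-tuple R) (a B c : R) :
    measurable A -> A `<=` unit_cube n -> a%:E <= borel_lebesgue A ->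
    (0 <= B)%R -> (forall i j, `|tnth (w i) j| <= B)%R ->
    (forall x, (#|[set i | `[< A (tuple_add x (w i)) >]]%SET|%:R <= c)%R) ->
  (#|I|%:R * a <= c * (1 + B + B) ^+ n)%R.
Proof.
move=> mA Acube aA B0 wB count.
pose mu : {measure set (euclid R n) -> \bar R} := @borel_lebesgue R n.
pose lo : euclid R n := [tuple (- B)%R | i < n].
pose hi : euclid R n := [tuple (1 + B)%R | i < n].
pose Q := [set x : euclid R n | forall i, (tnth lo i <= tnth x i <= tnth hi i)%R].
have mQ : measurable Q by exact: measurable_box.
have muQ : mu Q = ((1 + B + B) ^+ n)%:E.
  rewrite [LHS](@borel_lebesgue_box R n lo hi) => [|i];
    last by rewrite !tnth_mktuple; lra.
  congr (_%:E); rewrite -[X in _ = (_ ^+ X)%R]card_ord -prodr_const.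
  by apply: eq_bigr => i _; rewrite !tnth_mktuple opprK.
pose T i : set (euclid R n) := [set x : euclid R n | A (tuple_add x (w i))].
have mT i : measurable (T i).
  by rewrite -[X in measurable X]setTI; exact: measurable_tuple_add.
have TQ i : T i `<=` Q.
  move=> x /Acube Tx j; have := Tx j; have := wB i j.
  by rewrite /lo /hi !tnth_mktuple ler_norml => /andP[? ?] /andP[? ?]; lra.
have c0 : (0 <= c)%R by apply: le_trans (count [tuple 0%R | i < n]).
have : \int[mu]_(x in Q) (\sum_(i : I) (\1_(T i) x)%:E) <= \int[mu]_(x in Q) c%:E.
  apply: ge0_le_integral => //.
  - by move=> x _; apply: sume_ge0 => i _; rewrite lee_fin.
  - by apply: emeasurable_sum => i; apply/measurable_EFinP;
    exact: measurable_indic.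
  - move=> x _; rewrite sumEFin lee_fin; apply: le_trans (count x).
    rewrite -sum1_card natr_sum [leRHS]big_mkcond /=; apply: ler_sum => i _.
    rewrite indicE inE; case: asboolP => [Tx|nTx]; first by rewrite mem_set.
    by rewrite memNset.
rewrite integral_cst // -/mu muQ ge0_integral_sum //; last first.
  by move=> i; apply/measurable_EFinP; exact: measurable_indic.
move=> le_avg; rewrite -lee_fin [leRHS]EFinM; apply: le_trans le_avg.
have -> : (#|I|%:R * a)%:E = \sum_(i : I) a%:E.
  by rewrite sumEFin sumr_const mulr_natl.
apply: lee_sum => i _; rewrite integral_indic // (setIidl (@TQ i)).
by apply: le_trans aA _; rewrite -(borel_lebesgue_translate (w i) mA).
Qed.

End Measure.

(** * From the lattice to Euclidean space *)

Section Transfer.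
Context {R : realType}.

(** The linear image of the integer vector [k]: the unit of its [i]-th
    coordinate stands for the coefficient vector of degree [i.+1], scaled by [L
    ^- d]. *)
Definition lattice_point n d (P : n.-tuple {poly R}) (L : nat)
    (k : 'I_d -> nat) : n.-tuple R :=
  [tuple \sum_(i < d) (k i)%:R / L%:R ^+ d * (tnth P j)`_i.+1 | j < n].

Definition coef_bound n d (P : n.-tuple {poly R}) : R :=
  \sum_(j < n) \sum_(i < d) `|(tnth P j)`_i.+1|.

Lemma coef_bound_ge0 n d P : 0 <= @coef_bound n d P.
Proof. by apply: sumr_ge0 => j _; apply: sumr_ge0 => i _. Qed.

Lemma lattice_point_le n d (P : n.-tuple {poly R}) L (k : 'I_d -> nat) j :
  (0 < L)%N -> (forall i, (k i <= L ^ d)%N) ->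
  `|tnth (lattice_point P L k) j| <= coef_bound d P.
Proof.
move=> L0 kL; rewrite tnth_mktuple.
have Ld : 0 < L%:R ^+ d :> R by rewrite exprn_gt0 // ltr0n.
apply: (@le_trans _ _ (\sum_(i < d) `|(tnth P j)`_i.+1|)).
  apply: le_trans (ler_norm_sum _ _ _) _; apply: ler_sum => i _.
  rewrite normrM -[leRHS]mul1r; apply: ler_wpM2r => //.
  rewrite ger0_norm; last by rewrite divr_ge0 // ltW.
  by rewrite ler_pdivrMr // mul1r -natrX ler_nat.
rewrite /coef_bound (bigD1 j) //= lerDl; apply: sumr_ge0 => l _.
exact: sumr_ge0.
Qed.

(** The unit of degree [i.+1] in [lattice_point] is [L ^- d] and the curve
    moves by [(t / L) ^+ i.+1] in this degree, hence by a whole number of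
    units. *)
Lemma poly_curve_lattice n d (P : n.-tuple {poly R}) L (t : nat)
    (k : 'I_d -> nat) :
  (0 < L)%N -> (forall j, size (tnth P j) <= d.+1)%N ->
  (forall j, (tnth P j).[0] = 0) ->
  tuple_add (lattice_point P L k) (poly_curve P (t%:R / L%:R)) =
  lattice_point P L (fun i => k i + L ^ (d - i.+1) * t ^ i.+1)%N.
Proof.
move=> L0 Pd P0; apply: eq_from_tnth => j; rewrite !tnth_mktuple.
have L0' : L%:R != 0 :> R by rewrite pnatr_eq0 -lt0n.
rewrite (horner_coef_wide _ (Pd j)) big_ord_recl /= expr0 mulr1.
rewrite -horner_coef0 P0 add0r -big_split /=; apply: eq_bigr => i _.
rewrite natrD natrM !natrX mulrDl mulrDl; congr (_ + _).
rewrite /bump add1n mulrC; congr (_ * _); rewrite exprMn exprVn.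
have -> : L%:R ^+ d = L%:R ^+ (d - i.+1) * L%:R ^+ i.+1 :> R.
  by rewrite -exprD subnK.
by field; rewrite !expf_neq0.
Qed.

Lemma tuple_addA n (x y z : n.-tuple R) :
  tuple_add (tuple_add x y) z = tuple_add x (tuple_add y z).
Proof. by apply: eq_from_tnth => j; rewrite !tnth_mktuple addrA. Qed.

(** Sample [A] along a translate of the lattice, found by [translate_average].
    The coordinates below [L ^ d] are embedded in the integers modulo [2 * L ^
    d], where adding a displacement of size at most [L ^ d] causes no
    wrap-around; this costs the factor [2 ^+ d] in the density. *)
Lemma lattice_recurrence n d (P : n.-tuple {poly R}) :
    (forall j, size (tnth P j) <= d.+1)%N ->
    (forall j, (tnth P j).[0] = 0) ->
  exists L : nat -> nat, [/\ tame L, (forall D, 0 < L D)%N &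
    forall (D : nat) (eps : R) (A : set (euclid R n)),
      (2 <= D)%N -> 0 < eps ->
      2 ^+ d * (1 + coef_bound d P + coef_bound d P) ^+ n <= D%:R * eps ->
      measurable A -> A `<=` unit_cube n ->
      ((2 * eps)%:E <= borel_lebesgue A)%E ->
    exists (x : n.-tuple R) (t : nat),
      [/\ (0 < t)%N, A x & A (tuple_add x (poly_curve P (t%:R / (L D)%:R)))]].
Proof.
move=> Pd P0; have [N tN rec] := @discrete_recurrence R d.
exists (fun D => (N D + 1)%N); split.
- exact: (tameD tN (tame_const 1)).
- by move=> D; rewrite addn1.
move=> D eps A D2 eps0; set L := (N D + 1)%N.
have L0 : (0 < L)%N by rewrite /L addn1.
set V := (_ ^+ n) => dense mA Acube volA.
have V0 : 0 < V by rewrite exprn_gt0 //; have := coef_bound_ge0 d P; lra.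
have Ld0 : (0 < L ^ d)%N by rewrite expn_gt0 L0.
pose I := {ffun 'I_d -> 'I_(L ^ d)}.
pose w (k : I) := lattice_point P L (fun i => k i).
have cardI : #|I| = ((L ^ d) ^ d)%N by rewrite card_ffun !card_ord.
have I0 : 0 < #|I|%:R :> R by rewrite ltr0n cardI expn_gt0 Ld0.
have [x0 many] : exists x0, #|I|%:R * eps / V <
    #|[set k : I | `[< A (tuple_add x0 (w k)) >]]%SET|%:R.
  apply: contrapT => none.
  have avg : #|I|%:R * (2 * eps) <= #|I|%:R * eps / V * V.
    apply: (@translate_average R n A I w _ (coef_bound d P)) => //.
    - exact: coef_bound_ge0.
    - by move=> k j; apply: lattice_point_le => // i; exact: ltnW.
    - by move=> x; rewrite leNgt; apply/negP => more; apply: none; exists x.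
  have : 0 < #|I|%:R * eps by rewrite mulr_gt0.
  by move: avg; rewrite divfK ?gt_eqF // mulrCA; lra.
set S := [set k : I | _]%SET in many.
pose M := (2 * L ^ d)%N; have M0 : (0 < M)%N by rewrite muln_gt0 Ld0.
have LM : (L ^ d <= M)%N by rewrite leq_pmull.
pose widen (k : I) : {ffun 'I_d -> 'I_M} := [ffun i => widen_ord LM (k i)].
have widen_inj : injective widen.
  move=> k k' /ffunP eqk; apply/ffunP => i; have := eqk i; rewrite !ffunE.
  by move/(congr1 val) => /= /val_inj.
have dense' : (M ^ d < D * #|(widen @: S)%SET|)%N.
  rewrite card_imset // /M expnMn -cardI -(ltr_nat R) !natrM natrX.
  have D0 : 0 < D%:R :> R by rewrite ltr0n (leq_trans _ D2).
  apply: (@le_lt_trans _ _ (D%:R * (#|I|%:R * eps / V)));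
    last by rewrite ltr_pM2l.
  rewrite !mulrA ler_pdivlMr // mulrAC [D%:R * _]mulrC -[leRHS]mulrA mulrC.
  by apply: ler_wpM2l => //; exact: ltW.
have [t [_ [_ [/andP[t0 tN'] /imsetP[k kS ->] /imsetP[k' k'S ->] kk']]]] :=
  rec _ _ (fun i => L ^ (d - i.+1))%N _ D2 M0 dense'.
exists (tuple_add x0 (w k)), t; split => //.
  by move: kS; rewrite inE => /asboolP.
rewrite tuple_addA /w poly_curve_lattice //.
move: k'S; rewrite inE => /asboolP; congr (A (tuple_add x0 _)).
rewrite /w; congr lattice_point; apply/funext => i.
have k'M : (k' i < M)%N by exact: leq_trans (ltn_ord _) LM.
have kM : (k i + L ^ (d - i.+1) * t ^ i.+1 < M)%N.
  rewrite /M mul2n -addnn -addSn; apply: leq_add => //.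
  apply: (@leq_trans (L ^ (d - i.+1) * L ^ i.+1)).
    rewrite leq_mul2l; apply/orP; right; apply: leq_expl.
    by rewrite (leq_trans tN') // leq_addr.
  by rewrite -expnD subnK.
by have := kk' i; rewrite !ffunE /= !modn_small.
Qed.

End Transfer.

(** With [D] of order [1 / eps], a tame bound [2 ^ (D ^ a)] is absorbed by the
    double exponential through [m <= expR m]. *)
Lemma tame_doubly_exp (R : realType) (L : nat -> nat) (C : R) :
  tame L -> 0 < C ->
  exists2 c : R, 0 < c & forall (eps : R) (D : nat), 0 < eps -> eps < 1 ->
    (2 <= D)%N -> (0 < L D)%N -> D%:R * eps <= C ->
    expR (- expR (c * eps ^- 4)) < 1 / (L D)%:R.
Proof.
move=> [a La] C0; exists (a%:R * C + 1).
  by have := mulr_ge0 (ler0n R a) (ltW C0); lra.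
move=> eps D eps0 eps1 D2 L0 DC; have L0' : 0 < (L D)%:R :> R by rewrite ltr0n.
rewrite expRN div1r ltf_pV2 ?posrE ?expR_gt0 //.
have expR_ge m : 1 + m%:R <= expR m%:R :> R by exact: expR_ge1Dx.
apply: (@le_lt_trans _ _ (expR (D ^ a)%:R)).
  apply: (@le_trans _ _ (2 ^ D ^ a)%:R); first by rewrite ler_nat La.
  rewrite natrX -[in leRHS](mulr1 (D ^ a)%:R) expRM_natl.
  by rewrite lerXn2r ?nnegrE ?expR_ge0 //; have := expR_ge 1%N; lra.
rewrite ltr_expR; apply: (@le_lt_trans _ _ (expR (a%:R * D%:R))).
  rewrite natrX expRM_natl lerXn2r ?nnegrE ?expR_ge0 //.
  by have := expR_ge D; lra.
rewrite ltr_expR.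
have eps4 : 0 < eps ^+ 4 by rewrite exprn_gt0.
have eps41 : eps ^+ 4 <= eps by rewrite -[leRHS]expr1 ler_wiXn2l ?ltW.
rewrite ltr_pdivlMr //.
have : a%:R * D%:R * eps ^+ 4 <= a%:R * C.
  rewrite -mulrA; apply: ler_wpM2l => //; apply: le_trans DC.
  by apply: ler_wpM2l.
by lra.
Qed.

Theorem theorem1p1 (R : realType) (n : nat) (P : n.-tuple {poly R})
    (n_ge1 : (1 <= n)%N)
    (P_neq0 : forall i : 'I_n, tnth P i != 0)
    (P_at0 : forall i : 'I_n, (tnth P i).[0] = 0) :
  exists2 c : R, 0 < c &
    forall (eps : R) (E : set (n.-tuple R)),
      0 < eps -> eps < 1 / 2 ->
      lebesgue_measurable E -> E `<=` unit_cube n ->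
      (eps%:E <= lebesgue_vol E)%E ->
      exists (x : n.-tuple R) (t : R),
        [/\ E x, E (tuple_add x (poly_curve P t)) &
            expR (- expR (c * eps ^- 4)) < t].
Proof.
pose d := (\max_(j < n) size (tnth P j))%N.
have Pd j : (size (tnth P j) <= d.+1)%N.
  by apply: leqW; exact: (leq_bigmax j).
have [L [tL L0 rec]] := lattice_recurrence Pd P_at0.
pose V := 2 ^+ d * (1 + coef_bound d P + coef_bound d P) ^+ n.
have V0 : 0 < V.
  have B0 := coef_bound_ge0 d P.
  by apply: mulr_gt0; rewrite exprn_gt0 //; lra.
have C0 : 0 < 4 * V + 2 by lra.
have [c c0 bound] := tame_doubly_exp tL C0.
exists c => // eps E eps0 eps12 mE Ecube volE.
have [A [mA AE volA]] := inner_borel eps0 mE Ecube volE.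
(* The inverse density: [D] must exceed [V / (eps / 4)] and be at least 2. *)
pose D := (Num.truncn (4 * V / eps)).+2.
have quot0 : 0 <= 4 * V / eps by apply: divr_ge0; lra.
have /andP[Dge Dle] := truncn_itv quot0.
have DV : V <= D%:R * (eps / 4).
  have : 4 * V / eps <= D%:R.
    by apply: le_trans (ltW Dle) _; rewrite ler_nat.
  by rewrite ler_pdivrMr //; lra.
have DC : D%:R * eps <= 4 * V + 2.
  have : (D%:R - 2) * eps <= 4 * V.
    rewrite -ler_pdivlMr // /D -addn2 natrD addrK.
    exact: Dge.
  by lra.
have eps4 : 0 < eps / 4 by rewrite divr_gt0.
have [||x [t [t0 Ax Axt]]] := rec D (eps / 4) A isT eps4 DV mA.
- by move=> x /AE /Ecube.
- by rewrite (_ : 2 * (eps / 4) = eps / 2) //; lra.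
exists x, (t%:R / (L D)%:R); split; [exact: AE|exact: AE|].
apply: (@lt_le_trans _ _ (1 / (L D)%:R)).
  by apply: bound => //; lra.
by apply: ler_wpM2r; rewrite ?invr_ge0 ?ler_nat // ler1n.
Qed.
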